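(* Let $\mathbf{M}\in\mathbb{Z}^{n\times n}$ (not necessarily symmetric), let $\Delta_{\mathbf{M}}$ be the discriminant of its characteristic polynomial, and let $p$ be an odd prime. Then $p \parallel \Delta_{\mathbf{M}}$ if and only if there exists $a\in \mathbb{Z}$ such that both of the following hold, with isomorphisms as $\mathbb{Z}[x]$-modules: (i) for every monic $\beta\in\mathbb{Z}[x]$ with irreducible reduction in $\mathbb{F}_p[x]$ and $\beta \not\equiv x - a \bmod p$, $$\frac{\operatorname{coker}(\mathbf{M} - x\mathbf{I})_{p,\beta}}{p \operatorname{coker}(\mathbf{M} - x\mathbf{I})_{p,\beta}} \cong 0 \qquad\text{or}\qquad \frac{\operatorname{coker}(\mathbf{M} - x\mathbf{I})_{p,\beta}}{p \operatorname{coker}(\mathbf{M} - x\mathbf{I})_{p,\beta}} \cong \frac{\mathbb{F}_p[x]}{\beta(x)\mathbb{F}_p[x] };$$ (ii) $$\frac{\operatorname{coker}(\mathbf{M} - x\mathbf{I})_{p,x-a}}{p\operatorname{coker}(\mathbf{M} - x\mathbf{I})_{p,x-a}} \cong \frac{\mathbb{F}_{p}[x]}{(x-a)^2\mathbb{F}_{p}[x]} \quad\text{and}\quad \frac{\operatorname{coker}(\mathbf{M} - x\mathbf{I})_{p,x-a}}{(x-a)\operatorname{coker}(\mathbf{M} - x\mathbf{I})_{p,x-a}} \cong \frac{\mathbb{F}_{p}[x]}{(x-a)\mathbb{F}_{p}[x]}.$$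
   Context: $p\parallel d$ means $p\mid d$ but $p^2\nmid d$. $\Delta_{\mathbf{M}}$ is the discriminant of $\varphi_{\mathbf{M}}(\lambda)=\det(\lambda\mathbf{I}-\mathbf{M})$, where the discriminant of a monic $\phi\in\mathbb{Z}[x]$ of degree at least one is the resultant $\operatorname{Res}(\phi,\phi')$ of $\phi$ and its formal derivative (the sign convention is immaterial). $\operatorname{coker}(\mathbf{M}-x\mathbf{I})=\mathbb{Z}[x]^n/(\mathbf{M}-x\mathbf{I})\mathbb{Z}[x]^n$ as a $\mathbb{Z}[x]$-module, with $\mathbf{I}$ the identity. For a prime $p$ and a monic $\beta\in\mathbb{Z}[x]$ with irreducible reduction in $\mathbb{F}_p[x]$, $R_{p,\beta}$ denotes the completion of $\mathbb{Z}[x]$ at the maximal ideal $(p,\beta)$; equivalently the ring of formal series $\sum_{i\ge0}c_i\beta^i$ with $c_i\in\mathbb{Z}_p[x]$, $\deg c_i<\deg\beta$, i.e. $\mathbb{Z}_p[x][[y]]/(y-\beta(x))$. For a $\mathbb{Z}[x]$-module $\mathscr{M}$, $\mathscr{M}_{p,\beta}=\mathscr{M}\otimes_{\mathbb{Z}[x]}R_{p,\beta}$. *)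

(* Defs.v *)
From HB Require Import structures.
From mathcomp Require Import all_boot all_order all_algebra.
From mathcomp Require Import ring_quotient finmap boolp classical_sets.
From mathcomp.multinomials Require Import monalg.

Set Implicit Arguments.
Unset Strict Implicit.
Unset Printing Implicit Defensive.

Import GRing.Theory.
Local Open Scope classical_set_scope.
Local Open Scope quotient_scope.
Local Open Scope ring_scope.

Section Span.
Variables (A : pzRingType) (V : lmodType A) (X : set V).

(* The smallest submodule containing X. *)
Definition mspan : {pred V} := fun v : V =>
  `[< forall S : {pred V}, submod_closed S -> X `<=` [set` S] -> v \in S >].

Lemma mem_mspan v : X v -> v \in mspan.
Proof. by move=> Xv; apply/asboolP => S _; apply. Qed.

Lemma mspan_min (S : {pred V}) :
  submod_closed S -> X `<=` [set` S] -> {subset mspan <= S}.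
Proof. by move=> Sc XS v /asboolP; apply. Qed.

Lemma mspan_submod_closed : submod_closed mspan.
Proof.
split=> [|a u v /asboolP su /asboolP sv]; apply/asboolP => S Sc XS.
  by have [] := Sc.
by have [_] := Sc; apply; [apply: su | apply: sv].
Qed.

HB.instance Definition _ := GRing.isZmodClosed.Build V mspan
  (GRing.submod_closedB mspan_submod_closed).

Definition quotm : Type := {ideal_quot mspan}.
HB.instance Definition _ := GRing.Zmodule.on quotm.

Definition quotm_pi (v : V) : quotm := \pi_({ideal_quot mspan}) v.

Lemma quotm_eqP u v : reflect (quotm_pi u = quotm_pi v) (u - v \in mspan).
Proof.
have -> : (u - v \in mspan) = (quotm_pi u == quotm_pi v).
  exact: (@Quotient.idealrBE V mspan).
exact: eqP.
Qed.

Lemma quotm_piW (P : quotm -> Prop) :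
  (forall v, P (quotm_pi v)) -> forall q, P q.
Proof. by move=> Pv; apply: quotW. Qed.

Definition quotm_scale (a : A) (q : quotm) : quotm :=
  quotm_pi (a *: repr (q : {ideal_quot mspan})).

Lemma quotm_scaleE a v : quotm_scale a (quotm_pi v) = quotm_pi (a *: v).
Proof.
apply/quotm_eqP; rewrite -scalerBr.
have [s0 sl] := mspan_submod_closed.
have -> w : a *: w = a *: w + 0 by rewrite addr0.
by apply: sl => //; apply/quotm_eqP; rewrite /quotm_pi reprK.
Qed.

Lemma quotm_pi_is_zmod_morphism : zmod_morphism quotm_pi.
Proof. by move=> u v; rewrite /quotm_pi raddfB. Qed.
HB.instance Definition _ :=
  GRing.isZmodMorphism.Build V quotm quotm_pi quotm_pi_is_zmod_morphism.

Lemma quotm_scalerA a b q :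
  quotm_scale a (quotm_scale b q) = quotm_scale (a * b) q.
Proof. by elim/quotm_piW: q => v; rewrite !quotm_scaleE scalerA. Qed.
Lemma quotm_scale1r : left_id 1 quotm_scale.
Proof. by elim/quotm_piW => v; rewrite quotm_scaleE scale1r. Qed.
Lemma quotm_scalerDr : right_distributive quotm_scale +%R.
Proof.
move=> a; elim/quotm_piW => u; elim/quotm_piW => v.
by rewrite -raddfD !quotm_scaleE -raddfD scalerDr.
Qed.
Lemma quotm_scalerDl q : {morph quotm_scale^~ q : a b / a + b}.
Proof.
by move=> a b; elim/quotm_piW: q => v; rewrite !quotm_scaleE -raddfD scalerDl.
Qed.
HB.instance Definition _ := GRing.Zmodule_isLmodule.Build A quotm
  quotm_scalerA quotm_scale1r quotm_scalerDr quotm_scalerDl.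

Lemma quotm_pi_is_scalable : scalable quotm_pi.
Proof. by move=> a v; rewrite -quotm_scaleE. Qed.
HB.instance Definition _ :=
  GRing.isScalable.Build A V quotm *:%R quotm_pi quotm_pi_is_scalable.

End Span.

Definition mod_iso (A : pzRingType) (U V : lmodType A) : Prop :=
  exists f : {linear U -> V}, bijective f.

Definition coker (A : comNzRingType) (m n : nat) (B : 'M[A]_(m, n)) :
    lmodType A :=
  quotm [set B *m w | w in [set: 'cV[A]_n]].

(* phi only selects the A-module structure. *)
Definition restrict_scalars (A B : pzRingType) (phi : {rmorphism A -> B})
  (V : lmodType B) : Type := V.

Section RestrictScalars.
Variables (A B : pzRingType) (phi : {rmorphism A -> B}) (V : lmodType B).
Local Notation restrict_scalars := (restrict_scalars phi V).

HB.instance Definition _ := GRing.Zmodule.copy restrict_scalars V.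

Definition restrict_scale (a : A) (v : restrict_scalars) : restrict_scalars :=
  phi a *: (v : V).

Fact restrict_scalerA a b v :
  restrict_scale a (restrict_scale b v) = restrict_scale (a * b) v.
Proof. by rewrite /restrict_scale scalerA rmorphM. Qed.
Fact restrict_scale1r : left_id 1 restrict_scale.
Proof. by move=> v; rewrite /restrict_scale rmorph1 scale1r. Qed.
Fact restrict_scalerDr : right_distributive restrict_scale +%R.
Proof. by move=> a u v; apply: scalerDr. Qed.
Fact restrict_scalerDl v : {morph restrict_scale^~ v : a b / a + b}.
Proof. by move=> a b; rewrite /restrict_scale rmorphD scalerDl. Qed.
HB.instance Definition _ := GRing.Zmodule_isLmodule.Build A restrict_scalars
  restrict_scalerA restrict_scale1r restrict_scalerDr restrict_scalerDl.

End RestrictScalars.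

Section Tensor.
Variables (A : comNzRingType) (U V : lmodType A).
Local Open Scope ring_scope.
Local Notation free := {malg A[(U * V)%type]}.

Inductive tensor_rel : free -> Prop :=
| tensor_addl u u' v :
    tensor_rel (<< (u + u', v) >> - << (u, v) >> - << (u', v) >>)
| tensor_addr u v v' :
    tensor_rel (<< (u, v + v') >> - << (u, v) >> - << (u, v') >>)
| tensor_scalel a u v :
    tensor_rel (<< (a *: u, v) >> - a *: << (u, v) >>)
| tensor_scaler a u v :
    tensor_rel (<< (u, a *: v) >> - a *: << (u, v) >>).

Definition tensor : lmodType A := quotm (tensor_rel : set free).

End Tensor.

Section QuotientRing.
Variables (A : comNzRingType) (X : set A).

(* The quotient of A by the ideal generated by X. *)
Definition quotr : Type := quotm (V := A^o) X.
HB.instance Definition _ := GRing.Lmodule.on quotr.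

Definition quotr_pi (a : A^o) : quotr := quotm_pi (V := A^o) X a.
HB.instance Definition _ := GRing.Linear.copy quotr_pi (quotm_pi (V := A^o) X).

Lemma quotr_piW (P : quotr -> Prop) :
  (forall a, P (quotr_pi a)) -> forall q, P q.
Proof. exact: quotm_piW. Qed.

Definition quotr_mul (q r : quotr) : quotr :=
  (repr (q : {ideal_quot mspan (V := A^o) X}) : A) *: r.

Fact quotr_mulE a b : quotr_mul (quotr_pi a) (quotr_pi b) = quotr_pi (a * b).
Proof.
rewrite /quotr_mul; set a' := repr _.
rewrite -linearZ /=; apply/quotm_eqP.
rewrite -[_ *: _]/(a' * b) -mulrBl mulrC.
have [s0 sl] := mspan_submod_closed (V := A^o) X.
rewrite -[b * _]addr0; apply: (sl b) => //.
by apply/quotm_eqP; rewrite /quotm_pi reprK.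
Qed.

Fact quotr_mulA : associative quotr_mul.
Proof.
elim/quotr_piW => a; elim/quotr_piW => b; elim/quotr_piW => c.
by rewrite !quotr_mulE mulrA.
Qed.
Fact quotr_mulC : commutative quotr_mul.
Proof.
elim/quotr_piW => a; elim/quotr_piW => b.
by rewrite !quotr_mulE mulrC.
Qed.
Fact quotr_mul1 : left_id (quotr_pi 1) quotr_mul.
Proof.
by elim/quotr_piW => a; rewrite !quotr_mulE mul1r.
Qed.
Fact quotr_mulDl : left_distributive quotr_mul +%R.
Proof.
elim/quotr_piW => a; elim/quotr_piW => b; elim/quotr_piW => c.
by rewrite -raddfD !quotr_mulE mulrDl raddfD.
Qed.
HB.instance Definition _ := GRing.Zmodule_isComPzRing.Build quotr
  quotr_mulA quotr_mulC quotr_mul1 quotr_mulDl.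

Fact quotr_pi_is_monoid_morphism : monoid_morphism quotr_pi.
Proof. by split=> // a b; rewrite -quotr_mulE. Qed.
HB.instance Definition _ := GRing.isMonoidMorphism.Build A^o quotr quotr_pi
  quotr_pi_is_monoid_morphism.

Lemma quotr_scalerAl (a : A) (q r : quotr) : a *: (q * r) = (a *: q) * r.
Proof.
elim/quotr_piW: q => b; elim/quotr_piW: r => c.
have sE (d : A^o) : a *: quotr_pi d = quotr_pi (a *: d) by rewrite linearZ.
by rewrite sE -!rmorphM /= sE scalerAl.
Qed.

End QuotientRing.

Section Completion.
Variables (A : comNzRingType) (X : set A).

Definition ideal_gen : set A := [set` mspan (V := A^o) X].

(* The k-th power of the ideal generated by X. *)
Fixpoint ideal_exp (k : nat) : set A :=
  if k is k'.+1 then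
    [set` mspan (V := A^o) [set a * b | a in ideal_gen & b in ideal_exp k']]
  else setT.

Definition adic_prod : Type := forall k : nat, quotr (ideal_exp k).
HB.instance Definition _ := Choice.on adic_prod.

Implicit Types (u v w : adic_prod) (a b : A).

Lemma ap_ext u v : (forall k, u k = v k) -> u = v.
Proof. exact: functional_extensionality_dep. Qed.

Definition ap_zero : adic_prod := fun k => 0.
Definition ap_one : adic_prod := fun k => 1.
Definition ap_opp u : adic_prod := fun k => - u k.
Definition ap_add u v : adic_prod := fun k => u k + v k.
Definition ap_mul u v : adic_prod := fun k => u k * v k.
Definition ap_scale a u : adic_prod := fun k => a *: u k.

Fact ap_addA : associative ap_add.
Proof. by move=> u v w; apply: ap_ext => k; apply: addrA. Qed.
Fact ap_addC : commutative ap_add.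
Proof. by move=> u v; apply: ap_ext => k; apply: addrC. Qed.
Fact ap_add0 : left_id ap_zero ap_add.
Proof. by move=> u; apply: ap_ext => k; apply: add0r. Qed.
Fact ap_addN : left_inverse ap_zero ap_opp ap_add.
Proof. by move=> u; apply: ap_ext => k; apply: addNr. Qed.
HB.instance Definition _ :=
  GRing.isZmodule.Build adic_prod ap_addA ap_addC ap_add0 ap_addN.

Fact ap_mulA : associative ap_mul.
Proof. by move=> u v w; apply: ap_ext => k; apply: mulrA. Qed.
Fact ap_mulC : commutative ap_mul.
Proof. by move=> u v; apply: ap_ext => k; apply: mulrC. Qed.
Fact ap_mul1 : left_id ap_one ap_mul.
Proof. by move=> u; apply: ap_ext => k; apply: mul1r. Qed.
Fact ap_mulDl : left_distributive ap_mul +%R.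
Proof. by move=> u v w; apply: ap_ext => k; apply: mulrDl. Qed.
HB.instance Definition _ :=
  GRing.Zmodule_isComPzRing.Build adic_prod ap_mulA ap_mulC ap_mul1 ap_mulDl.

Fact ap_scalerA a b u : ap_scale a (ap_scale b u) = ap_scale (a * b) u.
Proof. by apply: ap_ext => k; apply: scalerA. Qed.
Fact ap_scale1r : left_id 1 ap_scale.
Proof. by move=> u; apply: ap_ext => k; apply: scale1r. Qed.
Fact ap_scalerDr : right_distributive ap_scale +%R.
Proof. by move=> a u v; apply: ap_ext => k; apply: scalerDr. Qed.
Fact ap_scalerDl u : {morph ap_scale^~ u : a b / a + b}.
Proof. by move=> a b; apply: ap_ext => k; apply: scalerDl. Qed.
HB.instance Definition _ := GRing.Zmodule_isLmodule.Build A adic_prod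
  ap_scalerA ap_scale1r ap_scalerDr ap_scalerDl.

(* u k is the image of u k.+1 under A / I^k.+1 -> A / I^k. *)
Definition adic_coherent : {pred adic_prod} := fun u =>
  `[< forall k, exists2 a, u k.+1 = quotr_pi _ a & u k = quotr_pi _ a >].

Fact adic_coherent_subring_closed : subring_closed adic_coherent.
Proof.
split=> [|u v /asboolP cu /asboolP cv|u v /asboolP cu /asboolP cv];
  apply/asboolP => k.
- by exists 1; rewrite rmorph1.
- have [a ua1 ua] := cu k; have [b vb1 vb] := cv k; exists (a - b).
    by rewrite raddfB /= -ua1 -vb1.
  by rewrite raddfB /= -ua -vb.
- have [a ua1 ua] := cu k; have [b vb1 vb] := cv k; exists (a * b).
    by rewrite rmorphM /= -ua1 -vb1.
  by rewrite rmorphM /= -ua -vb.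
Qed.
HB.instance Definition _ := GRing.isSubringClosed.Build adic_prod adic_coherent
  adic_coherent_subring_closed.

Fact adic_coherent_scaler_closed : GRing.scaler_closed adic_coherent.
Proof.
move=> c u /asboolP cu; apply/asboolP => k.
by have [a ua1 ua] := cu k; exists (c *: a); rewrite linearZ /= -?ua1 -?ua.
Qed.
HB.instance Definition _ := GRing.isScaleClosed.Build A adic_prod adic_coherent
  adic_coherent_scaler_closed.

(* The inverse limit of the rings A / I^k, I being the ideal generated by X. *)
Record adic_completion : Type := AdicCompletion {
  adic_val : adic_prod;
  adic_valP : adic_val \in adic_coherent }.

HB.instance Definition _ := [isSub for adic_val].
HB.instance Definition _ := [Choice of adic_completion by <:].
HB.instance Definition _ :=
  [SubChoice_isSubZmodule of adic_completion by <:].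
HB.instance Definition _ :=
  [SubZmodule_isSubLmodule of adic_completion by <:].
HB.instance Definition _ :=
  GRing.SubZmodule_isSubPzRing.Build _ _ adic_completion
    (GRing.subringClosedP _).
HB.instance Definition _ :=
  GRing.SubPzRing_isSubComPzRing.Build _ _ adic_completion.

Lemma adic_scalerAl (a : A) (u v : adic_completion) :
  a *: (u * v) = (a *: u) * v.
Proof.
by apply: val_inj; apply: ap_ext => k; apply: quotr_scalerAl.
Qed.

End Completion.

(* resultant uses the Sylvester matrix for the actual sizes of f and f'; over
   int, f' has degree deg f - 1, as in the usual discriminant of a monic f. *)
Definition discriminant (f : {poly int}) : int := resultant f f^`().

Definition exactly_divides (p : nat) (d : int) : bool :=
  (p%:Z %| d)%Z && ~~ (p%:Z ^+ 2 %| d)%Z.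

Definition redp (p : nat) : {poly int} -> {poly 'F_p} :=
  map_poly (intr : int -> 'F_p).
HB.instance Definition _ (p : nat) := GRing.RMorphism.on (@redp p).

(* F_p[x] / g F_p[x], as a Z[x]-module. *)
Definition Fpx_mod (p : nat) (g : {poly 'F_p}) : lmodType {poly int} :=
  quotm (V := restrict_scalars (@redp p) {poly 'F_p}^o)
    [set g * h | h in [set: {poly 'F_p}]].

(* The completion R_{p, beta} of Z[x] at the ideal (p, beta). *)
Definition local_ring (p : nat) (beta : {poly int}) : Type :=
  adic_completion [set (p%:R : {poly int}); beta].
HB.instance Definition _ p beta := GRing.ComPzRing.on (local_ring p beta).
HB.instance Definition _ p beta := GRing.Lmodule.on (local_ring p beta).

Definition localize (p : nat) (beta : {poly int}) (V : lmodType {poly int}) :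
    lmodType {poly int} :=
  tensor V (local_ring p beta).

(* V / a V. *)
Definition mod_scale (V : lmodType {poly int}) (a : {poly int}) :
    lmodType {poly int} :=
  quotm [set a *: v | v in [set: V]].

Definition coker_char n (M : 'M[int]_n) : lmodType {poly int} :=
  coker (map_mx polyC M - ('X%:M : 'M[{poly int}]_n)).

(* Z[x]^0 *)
Definition zero_mod : lmodType {poly int} := 'cV[{poly int}]_0.

(* Main.v *)
From HB Require Import structures.
Require Import Defs.
From mathcomp Require Import all_boot all_order all_algebra.
From mathcomp Require Import finmap boolp classical_sets.
From mathcomp Require Import qpoly qfpoly finfield separable.
From mathcomp Require Import ring zify.
From mathcomp.multinomials Require Import monalg.

Set Implicit Arguments.
Unset Strict Implicit.
Unset Printing Implicit Defensive.

Import GRing.Theory.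
Local Open Scope classical_set_scope.
Local Open Scope ring_scope.

(** Let [phi] be the characteristic polynomial of [M], [B = M - x], and [V] the
    cokernel of [B], that is, [Z^n] with [x] acting as [M]. Both sides of the
    equivalence say the same thing about the integer [a]: modulo [p], [phi] is
    [(x - a)^2 h] with [h] squarefree and [h(a) <> 0], and [p^2] does not divide
    [phi(a)]. This is [simple_double_root].

    The discriminant is the determinant of the Sylvester matrix [S] of [phi] and
    [phi']. If [p] divides it exactly, the adjugate of [S] is nonzero modulo [p],
    so the left kernel of [S] modulo [p] is a line and [phi], [phi'] have a linear
    common factor [x - a] modulo [p] ([size_gcdp_deriv]). As [p] is odd, [a] is a
    simple root of [phi'] modulo [p] and lifts to a root [b] of [phi'] modulo
    [p^2]; if [p^2] divided [phi(a)], then [b] would be a common root of [phi] and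
    [phi'] modulo [p^2], and [p^2] would divide the resultant
    ([exactly_divides_double_root]). Conversely, if [p^2] divided the resultant, a
    row of the adjugate of [S] would be a relation [U phi + W phi' = 0] modulo
    [p^2], nonzero modulo [p]; evaluated at [b] it gives [p^2 | phi(b)], whence
    [p^2 | phi(a)] ([double_root_exactly_divides]).

    On the side of the cokernel, let [R] be the completion at [I = (p, beta)], and
    let [T] be a module killed by a power of [I]. Then [R] acts on [T], and a map
    from [V] onto [T] whose kernel falls into [c V] after multiplication by
    elements invertible in [R] induces an isomorphism from [(V (x) R) / c] to [T]
    ([base_change_mod_iso]). Such maps come from the rows of the adjugate of [B]:
    if [\adj B i j] is not in [I], then row [i] of the adjugate identifies [V]
    with [Z[x] / phi] near [I] ([coker_adj_ker]), and so [(V (x) R) / p] with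
    [F_p[x] / beta^m], where [m] is the multiplicity of [beta] in [phi] modulo [p].
    That some entry of the adjugate is not in [I] follows by determinants from
    [m = 1], or from [p] dividing [phi(a)] exactly when [beta = x - a]; it also
    follows from [(V (x) R) / p] being cyclic, which bounds the corank of [B] over
    the residue field of [I] by one ([cyclic_coker_rank]). Finally, if [p^2]
    divided [phi(a)], then [(V (x) R) / (x - a)] would map onto [Z / p^2], and [p]
    could not kill it ([local_coker_not_sq]). *)

(** * Quotient modules and tensor products *)

Section QuotientModule.
Variables (A : pzRingType) (V : lmodType A) (X : set V).

Lemma quotm_pi_eq0 v : quotm_pi X v = 0 <-> v \in mspan X.
Proof. by rewrite -[v in v \in _]subr0; split=> [|/quotm_eqP] h;
  [apply/quotm_eqP; rewrite h raddf0 | rewrite h raddf0]. Qed.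

Lemma quotm_lift (W : lmodType A) (f : {linear V -> W}) :
  (forall v, X v -> f v = 0) ->
  exists F : {linear quotm X -> W}, forall v, F (quotm_pi X v) = f v.
Proof.
move=> fX.
have ker_sub : {subset mspan X <= [pred v | f v == 0]}.
  apply: mspan_min => [|v /= /fX fv]; last by apply/eqP.
  split=> [|a u v]; rewrite !inE ?linear0 // linearP => /eqP-> /eqP->.
  by rewrite scaler0 addr0.
have f_pi u v : quotm_pi X u = quotm_pi X v -> f u = f v.
  move=> /quotm_eqP /ker_sub; rewrite inE linearB subr_eq0; exact: eqP.
have /choice [F FE] : forall q : quotm X,
    exists w, forall v, quotm_pi X v = q -> f v = w.
  by elim/quotm_piW => v; exists (f v) => u; apply: f_pi.
have Flin : linear F.
  move=> a; elim/quotm_piW => u; elim/quotm_piW => v.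
  rewrite -(FE _ u erefl) -(FE _ v erefl) -[RHS]linearP; apply/esym/FE.
  exact: linearP.
pose FL := GRing.isLinear.Build _ _ _ _ F Flin.
pose G : {linear quotm X -> W} := HB.pack F FL.
by exists G => v; apply/esym/FE.
Qed.

End QuotientModule.

Lemma mspan_id (A : pzRingType) (V : lmodType A) (X : set V) :
  submod_closed [pred v | `[< X v >]] -> forall v, v \in mspan X <-> X v.
Proof.
move=> Xc v; split=> [vX|]; last exact: mem_mspan.
have /(_ v vX) : {subset mspan X <= [pred v | `[< X v >]]}.
  by apply: mspan_min => // u Xu; apply/asboolP.
by move/asboolP.
Qed.

Lemma mspan_range (A : pzRingType) (U V : lmodType A) (f : {linear U -> V}) v :
  v \in mspan [set f u | u in [set: U]] <-> exists u, v = f u.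
Proof.
rewrite mspan_id; first by split=> [[u _ <-]|[u ->]]; exists u.
split=> [|a u w]; first by apply/asboolP; exists 0; rewrite ?linear0.
move=> /asboolP[x _ <-] /asboolP[y _ <-]; apply/asboolP.
by exists (a *: x + y); rewrite ?linearP.
Qed.

Lemma inj_surj_mod_iso (A : pzRingType) (U V : lmodType A)
    (f : {linear U -> V}) :
  (forall u, f u = 0 -> u = 0) -> (forall v, exists u, f u = v) -> mod_iso U V.
Proof.
move=> f0 /choice[g gK]; exists f; exists g => // u.
by apply/eqP; rewrite -subr_eq0; apply/eqP/f0; rewrite linearB gK subrr.
Qed.

Lemma mod_iso_sym (A : pzRingType) (U V : lmodType A) :
  mod_iso U V -> mod_iso V U.
Proof.
move=> [f [g fK gK]].
have glin : linear g := can2_linear fK gK.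
pose GL := GRing.isLinear.Build _ _ _ _ g glin.
pose G : {linear V -> U} := HB.pack g GL.
by exists G; exists f.
Qed.

Lemma mod_iso_trans (A : pzRingType) (U V W : lmodType A) :
  mod_iso U V -> mod_iso V W -> mod_iso U W.
Proof.
move=> [f fb] [g gb]; exists (g \o f : {linear U -> W}); exact: bij_comp.
Qed.

Lemma mod_iso_cyclic (A : pzRingType) (U V : lmodType A) (v0 : V) :
  mod_iso U V -> (forall v, exists a : A, v = a *: v0) ->
  exists u0 : U, forall u, exists a : A, u = a *: u0.
Proof.
move=> [F [G FK GK]] v0P; exists (G v0) => u.
have [a aE] := v0P (F u); exists a.
by apply: (can_inj FK); rewrite aE linearZ GK.
Qed.

Lemma mod_iso_kill (A : pzRingType) (U V : lmodType A) (a : A) :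
  mod_iso U V -> (forall v : V, a *: v = 0) -> forall u : U, a *: u = 0.
Proof.
move=> [F [G FK GK]] aV u.
by apply: (can_inj FK); rewrite linearZ /= aV linear0.
Qed.

Section TensorTheory.
Variables (A : comNzRingType) (U V : lmodType A).

Definition pure_tensor (u : U) (v : V) : tensor U V := quotm_pi _ << (u, v) >>.

Lemma pure_tensorDl u u' v :
  pure_tensor (u + u') v = pure_tensor u v + pure_tensor u' v.
Proof.
apply/eqP; rewrite -subr_eq0 opprD addrA -!raddfB; apply/eqP.
by apply/quotm_pi_eq0/mem_mspan; apply: tensor_addl.
Qed.

Lemma pure_tensorDr u v v' :
  pure_tensor u (v + v') = pure_tensor u v + pure_tensor u v'.
Proof.
apply/eqP; rewrite -subr_eq0 opprD addrA -!raddfB; apply/eqP.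
by apply/quotm_pi_eq0/mem_mspan; apply: tensor_addr.
Qed.

Lemma pure_tensorZl a u v : pure_tensor (a *: u) v = a *: pure_tensor u v.
Proof.
apply/eqP; rewrite -subr_eq0 -linearZ -raddfB; apply/eqP.
by apply/quotm_pi_eq0/mem_mspan; apply: tensor_scalel.
Qed.

Lemma pure_tensorZr a u v : pure_tensor u (a *: v) = a *: pure_tensor u v.
Proof.
apply/eqP; rewrite -subr_eq0 -linearZ -raddfB; apply/eqP.
by apply/quotm_pi_eq0/mem_mspan; apply: tensor_scaler.
Qed.

Lemma pure_tensor_ind (P : tensor U V -> Prop) :
  P 0 -> (forall u v t, P t -> P (pure_tensor u v + t)) -> forall t, P t.
Proof.
move=> P0 PD; elim/quotm_piW => w; rewrite (monalgE w) raddf_sum.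
elim/big_rec: _ => //= -[u v] t _ Pt.
suff -> : quotm_pi (@tensor_rel A U V) << w@_(u, v) *g (u, v) >>
        = pure_tensor (w@_(u, v) *: u) v by apply: PD.
rewrite pure_tensorZl -linearZ; congr quotm_pi.
by apply/malgP => k; rewrite mcoeffZ !mcoeffU mulr_natr.
Qed.

(** The universal property of the tensor product. *)
Lemma tensor_lift (W : lmodType A) (f : U -> V -> W) :
  (forall v, linear (f^~ v)) -> (forall u, linear (f u)) ->
  exists F : {linear tensor U V -> W}, forall u v, F (pure_tensor u v) = f u v.
Proof.
move=> fl fr.
pose g (w : {malg A[(U * V)%type]}) : W := \sum_(k <- msupp w) w@_k *: f k.1 k.2.
have gE (d : {fset (U * V)%type}) w : (msupp w `<=` d)%fset ->
    g w = \sum_(k <- d) w@_k *: f k.1 k.2.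
  move=> sub; rewrite /g (big_fset_incl _ sub) //= => k _.
  by rewrite -mcoeff_eq0 => /eqP->; rewrite scale0r.
have glin : linear g.
  move=> a x y; pose d := (msupp x `|` msupp y `|` msupp (a *: x + y))%fset.
  rewrite !(gE d); try by apply/fsubsetP => k; rewrite !inE => ->; rewrite ?orbT.
  rewrite scaler_sumr -big_split; apply: eq_bigr => k _ /=.
  by rewrite mcoeffD mcoeffZ scalerDl scalerA.
pose GL := GRing.isLinear.Build _ _ _ _ g glin.
pose G : {linear {malg A[(U * V)%type]} -> W} := HB.pack g GL.
have GU u v : G << (u, v) >> = f u v.
  rewrite /G /= (gE [fset (u, v)]%fset) ?msuppU_le //.
  by rewrite big_seq_fset1 mcoeffUU scale1r.
have [F FE] : exists F : {linear tensor U V -> W},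
    forall v, F (quotm_pi _ v) = G v.
  apply: quotm_lift => _ [u u' v|u v v'|a u v|a u v].
  - by rewrite !linearB !GU (GRing.semilinear_linear (fl v)).2 -addrA -opprD subrr.
  - by rewrite !linearB !GU (GRing.semilinear_linear (fr u)).2 -addrA -opprD subrr.
  - by rewrite linearB linearZ !GU (GRing.semilinear_linear (fl v)).1 subrr.
  - by rewrite linearB linearZ !GU (GRing.semilinear_linear (fr u)).1 subrr.
by exists F => u v; rewrite FE GU.
Qed.

End TensorTheory.

(** * Completion at an ideal with two generators *)

Section Completion.
Variables (A : comNzRingType) (g h : A).
Local Notation X := [set g; h].

Lemma ideal_exp_submod k : submod_closed [pred a : A^o | `[< ideal_exp X k a >]].
Proof.
case: k => [|k]; first by split=> [|a u v _ _]; apply/asboolP.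
have [c0 cl] := mspan_submod_closed (V := A^o)
  [set a * b | a in ideal_gen X & b in ideal_exp X k].
split=> [|a u v /asboolP uI /asboolP vI]; apply/asboolP; first exact: c0.
exact: cl.
Qed.

Lemma ideal_exp0 k : ideal_exp X k 0.
Proof. by have [/asboolP] := ideal_exp_submod k. Qed.

Lemma ideal_expDM k a x y :
  ideal_exp X k x -> ideal_exp X k y -> ideal_exp X k (a * x + y).
Proof.
have [_ cl] := ideal_exp_submod k => xI yI.
by apply/asboolP/(cl a x y); apply/asboolP.
Qed.

Lemma ideal_expD k x y :
  ideal_exp X k x -> ideal_exp X k y -> ideal_exp X k (x + y).
Proof. by rewrite -[x in x + _]mul1r; apply: ideal_expDM. Qed.

Lemma ideal_expMl k a x : ideal_exp X k x -> ideal_exp X k (a * x).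
Proof. by rewrite -[a * x]addr0 => xI; apply: ideal_expDM => //; apply: ideal_exp0. Qed.

Lemma ideal_gen2P x : ideal_gen X x <-> exists a b, x = a * g + b * h.
Proof.
split=> [xI|[a [b ->]]]; last first.
  have [c0 cl] := mspan_submod_closed (V := A^o) X.
  apply: (cl a g (b * h)); first by apply: mem_mspan; left.
  by rewrite -[b * h]addr0; apply: (cl b h 0) => //; apply: mem_mspan; right.
suff /(_ x xI) /asboolP : {subset mspan (V := A^o) X <=
    [pred x | `[< exists a b, x = a * g + b * h >]]} by [].
apply: mspan_min => [|y [->|->]]; last 2 first.
- by apply/asboolP; exists 1, 0; ring.
- by apply/asboolP; exists 0, 1; ring.
split=> [|c u v /asboolP[a [b ->]] /asboolP[a' [b' ->]]]; apply/asboolP.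
  by exists 0, 0; ring.
exists (c * a + a'), (c * b + b').
by rewrite -[c *: _]/(c * _); ring.
Qed.

Lemma ideal_expSP k x : ideal_exp X k.+1 x <->
  exists y z, [/\ ideal_exp X k y, ideal_exp X k z & x = g * y + h * z].
Proof.
split=> [xI|[y [z [yI zI ->]]]]; last first.
  apply: ideal_expD; apply: mem_mspan.
    by exists g => //; [apply/ideal_gen2P; exists 1, 0; ring | exists y].
  by exists h => //; [apply/ideal_gen2P; exists 0, 1; ring | exists z].
suff /(_ x xI) /asboolP : {subset mspan (V := A^o)
      [set a * b | a in ideal_gen X & b in ideal_exp X k] <=
    [pred x | `[< exists y z, [/\ ideal_exp X k y, ideal_exp X k z
                               & x = g * y + h * z] >]]} by [].
apply: mspan_min => [|_ [_ /ideal_gen2P[a [b ->]] [y yI <-]]]; last first.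
  apply/asboolP; exists (a * y), (b * y).
  by split; [apply: ideal_expMl.. | ring].
split=> [|c u v /asboolP[a [b [aI bI ->]]] /asboolP[a' [b' [aI' bI' ->]]]];
  apply/asboolP.
  by exists 0, 0; split; [apply: ideal_exp0.. | ring].
exists (c * a + a'), (c * b + b'); split; try exact: ideal_expDM.
by rewrite -[c *: _]/(c * _); ring.
Qed.

Lemma ideal_expW k l x : (k <= l)%N -> ideal_exp X l x -> ideal_exp X k x.
Proof.
move=> /subnK <-; elim: (l - k)%N x => // m IH x.
case/ideal_expSP => y [z [/IH yI /IH zI ->]].
by apply: ideal_expD; apply: ideal_expMl.
Qed.

Lemma ideal_expX k t : ideal_exp X 1 t -> ideal_exp X k (t ^+ k).
Proof.
case/ideal_expSP => a [b [_ _ ->]]; elim: k => // k IH.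
rewrite exprS; apply/ideal_expSP.
exists (a * (g * a + h * b) ^+ k), (b * (g * a + h * b) ^+ k).
by split; [apply: ideal_expMl.. | ring].
Qed.

(** A monomial of degree [k + i + j] in [g] and [h] is divisible by [g ^+ i] or
    by [h ^+ j]. *)
Lemma ideal_exp_split k i j x : ideal_exp X (k + i + j) x ->
  exists y z, [/\ ideal_exp X (k + j) y, ideal_exp X (k + i) z
                & x = g ^+ i * y + h ^+ j * z].
Proof.
move: i j x; elim=> [|i IHi].
  move=> j x; rewrite addn0 => xI; exists x, 0.
  by split=> //; [apply: ideal_exp0 | ring].
elim=> [|j IHj] x.
  rewrite addn0 => xI; exists 0, x.
  by split=> //; [apply: ideal_exp0 | ring].
rewrite addnS => /ideal_expSP[y [z [yI zI ->]]].
have [|y1 [z1 [y1I z1I ->]]] := IHi j.+1 y.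
  by move: yI; congr ideal_exp; lia.
have [y2 [z2 [y2I z2I ->]]] := IHj z zI.
exists (y1 + h * y2), (g * z1 + z2); split; last by rewrite !exprS; ring.
  apply: ideal_expD => //; rewrite addnS; apply/ideal_expSP.
  by exists 0, y2; split; [apply: ideal_exp0 | | ring].
apply: ideal_expD => //; rewrite addnS; apply/ideal_expSP.
by exists z1, 0; split; [|apply: ideal_exp0 | ring].
Qed.

Lemma quotr_pi_eq k a b :
  quotr_pi (ideal_exp X k) a = quotr_pi _ b <-> ideal_exp X k (a - b).
Proof.
have idE c : quotr_pi (ideal_exp X k) c = 0 <-> ideal_exp X k c.
  rewrite (quotm_pi_eq0 (V := A^o)).
  exact: (mspan_id (V := A^o)) (ideal_exp_submod k) c.
have <- : quotr_pi (ideal_exp X k) a - quotr_pi _ b = 0 <-> ideal_exp X k (a - b).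
  by rewrite -idE raddfB.
by split=> [->|/eqP]; rewrite ?subrr // subr_eq0 => /eqP.
Qed.

Local Notation R := (adic_completion X).
Implicit Types r s : R.

Lemma adic_repr r : exists2 a : nat -> A,
  forall k, adic_val r k = quotr_pi _ (a k) &
  forall k l, (k <= l)%N -> ideal_exp X k (a l - a k).
Proof.
have /choice[a aE] k : exists a, adic_val r k = quotr_pi _ a.
  by elim/quotr_piW: (adic_val r k) => a; exists a.
exists a => // k l /subnK <-; elim: (l - k)%N => [|m IH].
  by rewrite subrr; apply: ideal_exp0.
rewrite addSn -[a _](subrK (a (m + k)%N)) -addrA; apply: ideal_expD => //.
have /asboolP/(_ (m + k)%N) [b] := adic_valP r.
rewrite !aE => /quotr_pi_eq h1 /quotr_pi_eq h0.
rewrite (_ : _ - _ = -1 * (a (m + k)%N - b) + (a (m + k).+1 - b)); last by ring.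
by apply: ideal_expDM; [apply: ideal_expW h0 | apply: ideal_expW h1]; lia.
Qed.

Lemma adic_limit (a : nat -> A) :
  (forall k, ideal_exp X k (a k.+1 - a k)) ->
  exists r, forall k, adic_val r k = quotr_pi _ (a k).
Proof.
move=> ac; pose v : adic_prod X := fun k => quotr_pi _ (a k).
have vP : v \in @adic_coherent A X.
  by apply/asboolP => k; exists (a k.+1) => //; apply/esym/quotr_pi_eq.
by exists (AdicCompletion vP).
Qed.

Lemma adic_ext r s : (forall k, adic_val r k = adic_val s k) -> r = s.
Proof. by move=> rs; apply: val_inj; apply: ap_ext. Qed.

(** An element vanishing modulo [I ^ (i + j)] is the sum of a series whose terms
    lie in higher and higher powers of [I]; these terms can be split one by one
    into multiples of [g ^+ i] and of [h ^+ j], with convergent cofactors. *)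
Lemma adic_val_eq0_split i j r : adic_val r (i + j)%N = 0 ->
  exists s1 s2, r = g ^+ i *: s1 + h ^+ j *: s2.
Proof.
have [a aE ac] := adic_repr r; set N := (i + j)%N => r0.
have aN : ideal_exp X N (a N).
  by rewrite -[a N]subr0 -quotr_pi_eq -aE r0 raddf0.
have [y0 [z0 [_ _ a0E]]] : exists y z,
    [/\ ideal_exp X (0 + j) y, ideal_exp X (0 + i) z & a N = g ^+ i * y + h ^+ j * z].
  by apply: ideal_exp_split.
have /choice[yz yzE] k : exists yz : A * A, [/\ ideal_exp X k yz.1, ideal_exp X k yz.2
    & a (N + k).+1 - a (N + k)%N = g ^+ i * yz.1 + h ^+ j * yz.2].
  have [|y [z [yI zI e]]] := @ideal_exp_split k i j (a (N + k).+1 - a (N + k)%N).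
    have -> : (k + i + j = N + k)%N by rewrite /N; lia.
    by apply: ac.
  by exists (y, z); split=> //; [apply: ideal_expW yI | apply: ideal_expW zI];
    apply: leq_addr.
have [|s1 s1E] := @adic_limit (fun k => y0 + \sum_(l < k) (yz l).1).
  move=> k; rewrite [_ - _](_ : _ = (yz k).1); last by rewrite big_ord_recr /=; ring.
  by have [] := yzE k.
have [|s2 s2E] := @adic_limit (fun k => z0 + \sum_(l < k) (yz l).2).
  move=> k; rewrite [_ - _](_ : _ = (yz k).2); last by rewrite big_ord_recr /=; ring.
  by have [] := yzE k.
exists s1, s2; apply: adic_ext => k.
transitivity (g ^+ i *: adic_val s1 k + h ^+ j *: adic_val s2 k); last by [].
have pZ c d : c *: quotr_pi (ideal_exp X k) d = quotr_pi _ (c * d).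
  by rewrite -linearZ.
rewrite s1E s2E !pZ -raddfD aE; apply/quotr_pi_eq.
rewrite [X in a k - X](_ : _ = a (N + k)%N); last first.
  elim: k {pZ} => [|k IH]; first by rewrite !big_ord0 !addr0 addn0 a0E.
  rewrite !big_ord_recr /= addnS -[RHS](subrK (a (N + k)%N)).
  by have [_ _ ->] := yzE k; rewrite -IH; ring.
rewrite -opprB -mulN1r; apply: ideal_expMl; apply: ac; exact: leq_addl.
Qed.

(** [c] becomes invertible in the completion because [d * (1 + t + t ^+ 2 + ...)]
    converges, where [c * d = 1 - t]. *)
Lemma adic_divisible c d r : ideal_exp X 1 (1 - c * d) -> exists s, r = c *: s.
Proof.
set t := 1 - c * d => tI; have [a aE ac] := adic_repr r.
have [|s sE] := @adic_limit (fun k => d * (\sum_(l < k) t ^+ l) * a k).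
  move=> k; rewrite big_ord_recr /=.
  rewrite [X in ideal_exp _ _ X](_ : _ = d * (\sum_(l < k) t ^+ l) * (a k.+1 - a k)
      + d * a k.+1 * t ^+ k); last by ring.
  by apply: ideal_expDM; [apply: ac | apply: ideal_expMl; apply: ideal_expX].
exists s; apply: adic_ext => k.
transitivity (c *: adic_val s k); last by [].
rewrite sE aE -linearZ; apply/quotr_pi_eq.
rewrite [X in ideal_exp _ _ X](_ : _ = a k * t ^+ k); last first.
  rewrite -[_ *: _]/(c * _) !mulrA.
  have -> : c * d = 1 - t by rewrite /t; ring.
  have -> : (1 - t) * \sum_(l < k) t ^+ l = 1 - t ^+ k.
    by rewrite -[RHS]opprB subrX1; ring.
  by ring.
by apply: ideal_expMl; apply: ideal_expX.
Qed.

End Completion.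

(** * Base change to the completion *)

Section BaseChange.
Variables (A : comNzRingType) (g h : A).
Local Notation X := [set g; h].
Local Notation R := (adic_completion X).
Variables (V T : lmodType A) (pi : {linear V -> T}).
Variables (i j : nat).
Hypotheses (gT : forall t : T, g ^+ i *: t = 0) (hT : forall t : T, h ^+ j *: t = 0).

Lemma ideal_exp_kill x (t : T) : ideal_exp X (i + j) x -> x *: t = 0.
Proof.
case/(@ideal_exp_split _ g h 0 i j) => y [z [_ _ ->]].
by rewrite scalerDl (mulrC (g ^+ i)) (mulrC (h ^+ j)) -!scalerA gT hT !scaler0 addr0.
Qed.

(** As [I ^ (i + j)] kills [T], the completion acts on [T] through its component
    in [A / I ^ (i + j)], and [pi] extends to the base change of [V]. *)
Lemma base_change_lift : exists F : {linear tensor V R -> T},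
  forall v (r : R) (a : A), adic_val r (i + j)%N = quotr_pi _ a ->
    F (pure_tensor v r) = a *: pi v.
Proof.
have /choice[a aE] (r : R) : exists a : A, adic_val r (i + j)%N = quotr_pi _ a.
  by elim/quotr_piW: (adic_val r _) => a; exists a.
have act_eq (r : R) (b : A) (t : T) :
    adic_val r (i + j)%N = quotr_pi _ b -> a r *: t = b *: t.
  rewrite aE => /quotr_pi_eq /(@ideal_exp_kill _ t) /eqP.
  by rewrite scalerBl subr_eq0 => /eqP.
have [||F FE] := @tensor_lift A V R T (fun v r => a r *: pi v).
- move=> r c u v.
  by rewrite linearP scalerDr !scalerA mulrC.
- move=> v c r s; rewrite scalerA -scalerDl; apply: act_eq.
  transitivity (c *: adic_val r (i + j)%N + adic_val s (i + j)%N); first by [].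
  rewrite !aE.
  exact/esym/(linearP (quotm_pi (V := A^o) (ideal_exp X (i + j)))).
by exists F => v r b rb; rewrite FE; apply: act_eq.
Qed.

Variable c : A.
Hypothesis cT : forall t : T, c *: t = 0.
Local Notation VRc := (quotm [set c *: t | t in [set: tensor V R]]).

Lemma base_change_mod_lift : exists F : {linear VRc -> T},
  forall v (r : R) (a : A), adic_val r (i + j)%N = quotr_pi _ a ->
    F (quotm_pi _ (pure_tensor v r)) = a *: pi v.
Proof.
have [F FE] := base_change_lift.
have [|G GE] := @quotm_lift A (tensor V R) [set c *: t | t in [set: tensor V R]] T F.
  by move=> _ [t _ <-]; rewrite linearZ /= cT.
by exists G => v r a /FE; rewrite GE.
Qed.

Definition base_change_class (v : V) : VRc := quotm_pi _ (pure_tensor v (1 : R)).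

Hypothesis pi_surj : forall t, exists v, pi v = t.
Hypothesis pi_ker : forall v, pi v = 0 ->
  exists (a b : A) w, [/\ ideal_exp X 1 (1 - a * b) & a *: v = c *: w].

(** An element of [V] that an element invertible in the completion sends into
    [c V] dies in the quotient of the base change by [c]; so the kernel of [pi]
    disappears. Moreover, each [v (x) r] is congruent to some [w (x) 1], as [r] is
    the sum of an element of [A] and a combination of [g ^+ i] and [h ^+ j], which
    send [v] into that kernel. *)
Lemma base_change_mod_iso : mod_iso VRc T.
Proof.
have [F FE] := base_change_mod_lift.
have F1 v : F (base_change_class v) = pi v.
  by rewrite (FE _ _ 1) ?scale1r //.
have ker_class v r : pi v = 0 -> quotm_pi _ (pure_tensor v r) = 0 :> VRc.
  case/pi_ker => a [b [w [abI avE]]]; have [s ->] := adic_divisible r abI.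
  rewrite pure_tensorZr -pure_tensorZl avE pure_tensorZl.
  by apply/quotm_pi_eq0/mem_mspan; exists (pure_tensor w s).
have classD u v : base_change_class (u + v)
    = base_change_class u + base_change_class v.
  by rewrite /base_change_class pure_tensorDl raddfD.
have pure_class v r : exists w,
    quotm_pi _ (pure_tensor v r) = base_change_class w.
  have [a aE _] := adic_repr r.
  have [|s1 [s2 sE]] := @adic_val_eq0_split _ g h i j (r - a (i + j)%N *: (1 : R)).
    transitivity (adic_val r (i + j)%N
      - a (i + j)%N *: quotr_pi (ideal_exp X (i + j)) 1); first by [].
    by rewrite aE -linearZ -[_ *: 1]/(a (i + j)%N * 1) mulr1 subrr.
  exists (a (i + j)%N *: v); apply/eqP; rewrite -subr_eq0; apply/eqP.
  transitivity (quotm_pi [set c *: t | t in [set: tensor V R]]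
    (pure_tensor v (r - a (i + j)%N *: (1 : R)))).
    rewrite -raddfB -scaleNr pure_tensorDr pure_tensorZr pure_tensorZl.
    by rewrite scaleNr.
  rewrite sE pure_tensorDr !pure_tensorZr -!pure_tensorZl raddfD /=.
  by rewrite !ker_class ?addr0 // linearZ /= ?gT ?hT.
have all_class q : exists v, q = base_change_class v.
  elim/quotm_piW: q => t; elim/pure_tensor_ind: t => [|v r t [w IH]].
    exists 0; rewrite raddf0; apply/esym/eqP.
    by have /eqP := classD 0 0; rewrite addr0 eq_sym -subr_eq0 addrK.
  have [u uE] := pure_class v r; exists (u + w).
  by rewrite raddfD classD -uE -IH.
apply: (inj_surj_mod_iso (f := F)) => [q|t].
  by have [v ->] := all_class q; rewrite F1; apply: ker_class.
by have [v <-] := pi_surj t; exists (base_change_class v).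
Qed.

End BaseChange.

(** * Cokernels and adjugate matrices *)

Section Adjugate.
Variables (A : comNzRingType) (n : nat) (B : 'M[A]_n).

Lemma mul_row_adj i (w : 'cV[A]_n) :
  (row i (\adj B) *m (B *m w)) 0 0 = \det B * w i 0.
Proof. by rewrite -row_mul mulmxA mul_adj_mx mul_scalar_mx !mxE. Qed.

Definition replace_row (i j : 'I_n) : 'M[A]_n :=
  \matrix_(k, l) if k == j then (l == i)%:R else B k l.

Lemma det_replace_row i j : \det (replace_row i j) = \adj B i j.
Proof.
rewrite (expand_det_row _ j) (bigD1 i) //= big1 ?addr0 => [|l li].
  rewrite !mxE !eqxx mul1r /cofactor; congr (_ * \det _).
  by apply/matrixP => k l; rewrite !mxE eq_sym (negPf (neq_lift _ _)).
by rewrite mxE eqxx (negPf li) mul0r.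
Qed.

(** Cramer's rule for [B] with its row [j] replaced by the [i]-th unit row, a
    matrix of determinant [\adj B i j]. *)
Lemma adj_coker_reduce i j (u : 'cV[A]_n) : exists w : 'cV[A]_n,
  (\adj B i j * \adj B i j) *: u =
  B *m w + (\adj B i j * (row i (\adj B) *m u) 0 0) *: delta_mx j 0.
Proof.
set d := \adj B i j; set v := row i (\adj B).
set C := replace_row i j; have detC : \det C = d by apply: det_replace_row.
pose w := \adj C *m u.
have Cw : C *m w = d *: u by rewrite mulmxA mul_mx_adj detC mul_scalar_mx.
pose c := (d *: u - B *m w) j 0.
have cE : d *: u - B *m w = c *: delta_mx j 0.
  apply/colP => k; rewrite [RHS]mxE [delta_mx _ _ _ _]mxE andbT.
  have [-> | kj] := eqVneq k j; first by rewrite mulr1.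
  rewrite mulr0 -Cw !mxE -sumrB big1 // => l _.
  by rewrite mxE (negPf kj) subrr.
have dE : d * c = d * (v *m u) 0 0 - \det B * w i 0.
  rewrite -(mul_row_adj i w) -/v.
  have -> : d * c = (v *m (c *: (delta_mx j 0 : 'cV_n))) 0 0.
    by rewrite [LHS]mulrC -scalemxAr -colE /d /v !mxE.
  by rewrite -cE mulmxBr -scalemxAr !mxE.
exists (d *: w - (w i 0) *: (\adj B *m delta_mx j 0)).
rewrite mulmxBr -!scalemxAr (mulmxA _ (\adj B)) mul_mx_adj mul_scalar_mx.
rewrite -scalerA -[d *: u](subrK (B *m w)) cE scalerDr scalerA dE.
by apply/colP => k; rewrite !mxE; ring.
Qed.

Lemma coker_pi_eq0 m (C : 'M[A]_(m, n)) (u : 'cV[A]_m) :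
  quotm_pi _ u = 0 :> coker C <-> exists w, u = C *m w.
Proof.
rewrite quotm_pi_eq0.
exact: (mspan_range (mulmx C : {linear 'cV[A]_n -> 'cV[A]_m})).
Qed.

Lemma det_coker (v : coker B) : \det B *: v = 0.
Proof.
elim/quotm_piW: v => u; rewrite -linearZ; apply/coker_pi_eq0.
by exists (\adj B *m u); rewrite mulmxA mul_mx_adj mul_scalar_mx.
Qed.

(** A row of the adjugate sends the image of [B] into the multiples of [\det B],
    so it induces a map from the cokernel to any module killed by [\det B]. *)
Lemma coker_adj_lift i (T : lmodType A) (psi : {linear A^o -> T}) :
  (forall a, psi (\det B * a) = 0) ->
  exists F : {linear coker B -> T},
    forall u, F (quotm_pi _ u) = psi ((row i (\adj B) *m u) 0 0).
Proof.
move=> psi0; pose f (u : 'cV[A]_n) : T := psi ((row i (\adj B) *m u) 0 0).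
have flin : linear f.
  move=> a u v; rewrite /f -linearP; congr (psi _).
  by rewrite mulmxDr -scalemxAr !mxE.
pose FL := GRing.isLinear.Build _ _ _ _ f flin.
pose F : {linear 'cV[A]_n -> T} := HB.pack f FL.
have [|G GE] := @quotm_lift _ _ [set B *m w | w in [set: 'cV[A]_n]] T F.
  by move=> _ [w _ <-]; rewrite /F /= /f mul_row_adj.
by exists G => u; rewrite GE.
Qed.

(** Consequently, wherever [\adj B i j] is invertible, the [j]-th unit vector
    generates the cokernel, and row [i] of the adjugate detects its elements. *)
Lemma coker_adj_ker i j (u : 'cV[A]_n) :
  (\adj B i j * \adj B i j) *: (quotm_pi _ u : coker B) =
  (row i (\adj B) *m u) 0 0 *: (\adj B i j *: quotm_pi _ (delta_mx j 0)).
Proof.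
have [w wE] := adj_coker_reduce i j u.
rewrite scalerA -!linearZ; apply/eqP; rewrite -subr_eq0 -raddfB; apply/eqP.
apply/coker_pi_eq0; exists w; rewrite wE [in X in _ - X]mulrC.
by rewrite addrK.
Qed.

End Adjugate.

(** Divide [\adj B *m B = \det B] by [q] and take determinants. The resulting
    identity is impossible for a prime [q] that does not divide [e]: a prime
    dividing the determinant exactly cannot divide the whole adjugate. *)
Lemma adj_not_divisible (D : idomainType) n (B : 'M[D]_n) (q e : D) (C : 'M[D]_n) :
  q != 0 -> \det B = q * e -> \adj B = q *: C ->
  e ^+ n = \det C * (q * e).
Proof.
move=> q0 dB adjE.
have CB : C *m B = e%:M.
  have := mul_adj_mx B; rewrite adjE dB -scalemxAl.
  rewrite scalar_mxM mul_scalar_mx => /matrixP CB; apply/matrixP => k l.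
  by apply: (mulfI q0); have := CB k l; rewrite !mxE.
by rewrite -dB -det_mulmx CB det_scalar.
Qed.

Section AdjugateRank.
Variables (K : fieldType) (n : nat) (B : 'M[K]_n).

Lemma row_replace_row i j k :
  row k (replace_row B i j) = if k == j then delta_mx 0 i else row k B.
Proof. by apply/rowP => l; rewrite !mxE; case: eqP; rewrite !mxE. Qed.

(** The matrix [replace_row B i j] is invertible and differs from [B] in one row
    only. *)
Lemma adj_neq0_rank i j : \adj B i j != 0 -> (n <= (\rank B).+1)%N.
Proof.
rewrite -det_replace_row -unitfE -[_ \is a _]/(_ \in unitmx).
move=> /mxrank_unit rn; rewrite -[n in (n <= _)%N]rn.
have sub : (replace_row B i j <= B + (delta_mx 0 i : 'rV_n))%MS.
  apply/row_subP => k; rewrite row_replace_row.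
  case: eqP => _; first exact: addsmxSr.
  exact: submx_trans (row_sub k B) (addsmxSl _ _).
apply: leq_trans (mxrankS sub) _; apply: leq_trans (mxrank_adds_leqif _ _) _.
by rewrite -[(_ B).+1]addn1 leq_add2l rank_leq_row.
Qed.

(** If the rank is [n - 1], then replacing one row by a vector outside the row
    space gives an invertible matrix, whose determinant is an entry of the
    adjugate. *)
Lemma rank_adj_neq0 : (0 < n)%N -> (n <= (\rank B).+1)%N ->
  exists i j, \adj B i j != 0.
Proof.
move=> n0 rB; have [dB | dB] := eqVneq (\det B) 0; last first.
  apply: contrapT => adj0; pose k0 := Ordinal n0.
  case/eqP: dB; have := congr1 (fun C : 'M_n => C k0 k0) (mul_adj_mx B).
  rewrite [RHS]mxE eqxx mulr1n => <-; rewrite mxE big1 // => l _.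
  suff -> : \adj B k0 l = 0 by rewrite mul0r.
  by apply/eqP; apply: contrapT => /negP nz; apply: adj0; exists k0, l.
have /det0P[v /rV0Pn[j vj] vB] : \det B == 0 by apply/eqP.
have Bfull : ~~ row_full B.
  by rewrite row_full_unit unitmxE dB unitr0.
have [i iB] : exists i, ~~ ((delta_mx 0 i : 'rV_n) <= B)%MS.
  apply: contrapT => allB; case/negP: Bfull; rewrite -sub1mx.
  apply/row_subP => i; rewrite row1; apply: contrapT => /negP iB.
  by apply: allB; exists i.
exists i, j; rewrite -det_replace_row; set C := replace_row B i j.
have BC : (B <= C)%MS.
  apply/row_subP => k; have [->|kj] := eqVneq k j; last first.
    by have := row_sub k C; rewrite row_replace_row (negPf kj).
  have -> : row j B = delta_mx 0 i - (v 0 j)^-1 *: (v *m C).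
    have -> : v *m C = v 0 j *: (delta_mx 0 i - row j B).
      rewrite -[v *m C]subr0 -[X in _ - X]vB -mulmxBr mulmx_sum_row (bigD1 j) //=.
      rewrite big1 ?addr0 => [|l lj]; last first.
        by rewrite linearB /= row_replace_row (negPf lj) subrr scaler0.
      by rewrite linearB /= row_replace_row eqxx.
    by rewrite scalerA mulVf // scale1r opprB addrC subrK.
  rewrite addmx_sub //; last by rewrite eqmx_opp scalemx_sub // submxMl.
  by have := row_sub j C; rewrite row_replace_row eqxx.
have ltBC : (B < C)%MS.
  rewrite ltmxE BC; apply/negP => CB; case/negP: iB; apply: submx_trans CB.
  by have := row_sub j C; rewrite row_replace_row eqxx.
rewrite -unitfE -[_ \is a _]/(_ \in unitmx) -row_full_unit -col_leq_rank.
by apply: leq_trans rB _; apply: rank_ltmx.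
Qed.

End AdjugateRank.

(** * The rank of a cyclic cokernel *)

(** The left kernel of [B] over a field [K] gives a map from the base change to a
    vector space over [K], onto the columns of [kermx]. A cyclic source has an
    image of dimension at most one, so the left kernel is at most a line. *)
Lemma cyclic_coker_rank (A : comNzRingType) n (B : 'M[A]_n) (g h c : A)
    (K : fieldType) (rho : {rmorphism A -> K})
    (U : lmodType A) (u0 : U) :
  rho g = 0 -> rho h = 0 -> rho c = 0 ->
  mod_iso (quotm [set c *: t | t in
    [set: tensor (coker B) (adic_completion [set g; h])]]) U ->
  (forall u, exists a : A, u = a *: u0) ->
  (n <= (\rank (map_mx rho B)).+1)%N.
Proof.
move=> g0 h0 c0 iso /(mod_iso_cyclic iso)[x0 x0P]; set B' := map_mx rho B.
pose T : lmodType A := restrict_scalars rho 'cV[K]_n.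
pose f (u : 'cV[A]_n) : T := kermx B' *m map_mx rho u.
have flin : linear f.
  by move=> a u v; rewrite /f map_mxD map_mxZ mulmxDr -scalemxAr.
pose FL := GRing.isLinear.Build _ _ _ _ f flin.
pose F : {linear 'cV[A]_n -> T} := HB.pack f FL.
have [|pi piE] := @quotm_lift _ _ [set B *m w | w in [set: 'cV[A]_n]] T F.
  by move=> _ [w _ <-]; rewrite /F /= /f map_mxM mulmxA mulmx_ker mul0mx.
have kT a : rho a = 0 -> forall t : T, a ^+ 1 *: t = 0.
  by move=> a0 t; rewrite expr1 -[_ *: _]/(rho a *: (t : 'cV[K]_n)) a0 scale0r.
have [|G GE] := @base_change_mod_lift _ g h (coker B) T pi 1 1 (kT _ g0) (kT _ h0) c.
  exact: kT c c0.
pose t0 : 'cV[K]_n := G x0.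
have ker_col k : exists a : K, col k (kermx B') = a *: t0.
  have [a aE] := x0P (quotm_pi _ (pure_tensor
    (quotm_pi _ (delta_mx k 0) : coker B) (1 : adic_completion [set g; h]))).
  have := congr1 G aE; rewrite (GE _ _ 1) // scale1r piE linearZ /F /= /f.
  by rewrite map_delta_mx -colE => ->; exists (rho a).
have /choice[a aE] := ker_col.
have kerE : kermx B' = t0 *m \row_k a k.
  apply/matrixP => k l; have /colP/(_ k) := aE l.
  by rewrite !mxE big_ord1 !mxE mulrC.
have : (\rank (kermx B') <= 1)%N.
  by rewrite kerE; apply: leq_trans (mxrankM_maxl _ _) (rank_leq_col _).
by rewrite mxrank_ker leq_subLR addn1.
Qed.

(** * Reduction modulo a prime *)

Section Reduction.
Variables (p : nat) (p_pr : prime p).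

Lemma redp_nat : redp p p%:R = 0.
Proof. by rewrite rmorph_nat -polyC_natr pchar_Fp_0. Qed.

Lemma redp_surj (k : {poly 'F_p}) : exists f, redp p f = k.
Proof.
exists (\poly_(i < size k) ((nat_of_ord k`_i)%:Z)); apply/polyP => i.
rewrite coef_map coef_poly; case: ltnP => [_|ik] /=.
  by rewrite -pmulrn natr_Zp.
by rewrite rmorph0 nth_default.
Qed.

Lemma intr_Fp_eq0 (z : int) : (z%:~R == 0 :> 'F_p) = (p %| z)%Z.
Proof. by rewrite (dvdz_pcharf (pchar_Fp p_pr)). Qed.

Lemma redp_eq0 f : redp p f = 0 -> exists k, f = p%:R * k.
Proof.
move=> f0; exists (map_poly (fun z => (z %/ p)%Z) f); apply/polyP => i.
rewrite -polyC_natr coefCM coef_map_id0 ?div0z // mulrC natz divzK //.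
by rewrite -intr_Fp_eq0 -[_%:~R](coef_map (intr : int -> 'F_p)) -/(redp p f) f0 coef0.
Qed.

Lemma redp_eq f k : redp p f = redp p k -> exists r, f = k + p%:R * r.
Proof.
move=> e; have [|r rE] := @redp_eq0 (f - k); first by rewrite rmorphB /= e subrr.
by exists r; rewrite -rE addrC subrK.
Qed.

Lemma redp_dvdp f k : redp p f %| redp p k -> exists q r, k = f * q + p%:R * r.
Proof.
case/dvdpP => q; have [q' <-] := redp_surj q.
by rewrite -rmorphM mulrC => /redp_eq[r ->]; exists q', r.
Qed.

Lemma Fpx_mod_proj (k : {poly 'F_p}) :
  exists psi : {linear {poly int}^o -> Fpx_mod k},
    (forall f, psi f = 0 <-> k %| redp p f) /\ (forall t, exists f, psi f = t).
Proof.
pose W : lmodType {poly int} := restrict_scalars (@redp p) {poly 'F_p}^o.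
pose X : set W := [set k * h | h in [set: {poly 'F_p}]].
pose f (a : {poly int}^o) : Fpx_mod k := quotm_pi X (redp p a).
have flin : linear f.
  move=> a u v; rewrite /f -linearZ -raddfD; congr quotm_pi.
  by rewrite rmorphD rmorphM.
pose FL := GRing.isLinear.Build _ _ _ _ f flin.
pose F : {linear {poly int}^o -> Fpx_mod k} := HB.pack f FL.
exists F; split=> [a|].
  rewrite /F /= /f quotm_pi_eq0 mspan_id.
    split=> [[h _ <-]|/dvdpP[h ->]]; first exact: dvdp_mulr.
    by exists h; rewrite 1?mulrC.
  split=> [|c u v /asboolP[h _ <-] /asboolP[h' _ <-]]; apply/asboolP.
    by exists 0; rewrite ?mulr0.
  exists (redp p c * h + h') => //.
  by rewrite mulrDr mulrCA.
elim/quotm_piW => v; have [a aE] := redp_surj v; exists a.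
by rewrite /F /= /f aE.
Qed.

Lemma Fpx_mod_ann (k : {poly 'F_p}) f :
  (forall t : Fpx_mod k, f *: t = 0) <-> k %| redp p f.
Proof.
have [psi [psi0 psi_surj]] := Fpx_mod_proj k; split=> [f0|kf t].
  by apply/psi0; rewrite -[f]mulr1 -[_ * _]/(f *: (1 : {poly int}^o)) linearZ /= f0.
have [a <-] := psi_surj t; rewrite -linearZ; apply/psi0.
by rewrite rmorphM dvdp_mulr.
Qed.

Lemma Fpx_mod_iso_dvdp (k l : {poly 'F_p}) :
  mod_iso (Fpx_mod k) (Fpx_mod l) -> l %| k.
Proof.
case=> F [G FK GK]; have [f fE] := redp_surj k.
rewrite -[k in _ %| k]fE; apply/Fpx_mod_ann => t; rewrite -(GK t) -linearZ.
have /Fpx_mod_ann -> : k %| redp p f by rewrite fE.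
by rewrite linear0.
Qed.

Lemma redp_horner f a : (redp p f).[a%:~R] = (f.[a])%:~R.
Proof. exact: horner_map. Qed.

Lemma residue_field (k : {poly 'F_p}) : k \is monic -> irreducible_poly k ->
  exists (K : fieldType) (rho : {rmorphism {poly int} -> K}),
    forall f, (rho f == 0) = (k %| redp p f).
Proof.
move=> km kirr; have kI : monic_irreducible_poly k by split.
exists {poly %/ k with kI}, (in_qpoly k \o redp p) => f /=.
by rewrite -val_eqE /= mk_monicE // -Pdiv.IdomainMonic.modpE.
Qed.

Lemma coprimep_adic_unit beta f : coprimep (redp p f) (redp p beta) ->
  exists d, ideal_exp [set (p%:R : {poly int}); beta] 1 (1 - f * d).
Proof.
case/Bezout_eq1_coprimepP => -[u v] /= uv.
have [u' u'E] := redp_surj u; have [v' v'E] := redp_surj v.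
have [|r rE] := @redp_eq0 (1 - f * u' - v' * beta).
  by rewrite !rmorphB !rmorphM rmorph1 /= u'E v'E -uv; ring.
exists u'; apply: (proj2 (@ideal_expSP _ (p%:R : {poly int}) beta 0 _)).
exists r, v'; split=> //.
by rewrite -rE; ring.
Qed.

End Reduction.

(** * The localized cokernel of [M - x] *)

Section LocalCokernel.
Variables (n : nat) (M : 'M[int]_n) (p : nat) (p_pr : prime p).
Local Notation B := (map_mx polyC M - ('X%:M : 'M[{poly int}]_n)).
Local Notation phi := (char_poly M).

Lemma det_coker_char : \det B = (-1) ^+ n * phi.
Proof.
by rewrite /char_poly /char_poly_mx -detZ scaleN1r opprB.
Qed.

Lemma char_poly_coker (v : coker_char M) : phi *: v = 0.
Proof.
have -> : phi = (-1) ^+ n * \det B by rewrite det_coker_char signrMK.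
by rewrite -scalerA (det_coker (B := B)) scaler0.
Qed.

Variable beta : {poly int}.
Local Notation X := [set (p%:R : {poly int}); beta].

(** Here [phi], which kills the cokernel, is invertible at [(p, beta)]. *)
Lemma local_coker_zero (T : lmodType {poly int}) c : (forall t : T, t = 0) ->
  coprimep (redp p phi) (redp p beta) ->
  mod_iso (mod_scale (localize p beta (coker_char M)) c) T.
Proof.
move=> T0 /(coprimep_adic_unit p_pr)[d dI].
pose f (v : coker_char M) : T := 0.
have flin : linear f by move=> a u v; rewrite /f scaler0 addr0.
pose FL := GRing.isLinear.Build _ _ _ _ f flin.
pose F : {linear coker_char M -> T} := HB.pack f FL.
apply: (@base_change_mod_iso _ p%:R beta (coker_char M) T F 0 0) => // [t|v _].
  by exists 0; rewrite [t]T0 [LHS]T0.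
by exists phi, d, 0; split=> //; rewrite char_poly_coker scaler0.
Qed.

(** Row [i] of the adjugate of [M - x] maps the cokernel onto a cyclic module.
    Multiplication by [e * \adj B i j ^+ 2], which is invertible at [(p, beta)],
    sends the kernel of that map into the multiples of [c]. *)
Lemma local_coker_cyclic m (c e : {poly int}) i j :
    coprimep (redp p (\adj B i j)) (redp p beta) ->
    coprimep (redp p e) (redp p beta) ->
    redp p beta ^+ m %| redp p phi -> redp p beta ^+ m %| redp p c ->
    (forall f, redp p beta ^+ m %| redp p f ->
       exists s r, e * f = phi * s + c * r) ->
  mod_iso (mod_scale (localize p beta (coker_char M)) c)
          (Fpx_mod (redp p beta ^+ m)).
Proof.
set d := \adj B i j => db eb phib cb fE.
have [psi [psi0 psi_surj]] := Fpx_mod_proj (redp p beta ^+ m).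
have [|F FE] := @coker_adj_lift _ _ B i _ psi.
  move=> a; apply/psi0; rewrite det_coker_char !rmorphM /=.
  by apply: dvdp_mulr; apply: dvdp_mull.
have annT f : redp p beta ^+ m %| redp p f ->
    forall t : Fpx_mod (redp p beta ^+ m), f *: t = 0.
  by move/Fpx_mod_ann.
apply: (@base_change_mod_iso _ p%:R beta (coker_char M) _ F 1 m).
- by apply: annT; rewrite expr1 redp_nat // dvdp0.
- by apply: annT; rewrite rmorphXn.
- exact: annT.
- move=> t; have [f <-] := psi_surj t.
  have /Bezout_eq1_coprimepP[[u v] /= uv] : coprimep (redp p d) (redp p beta ^+ m).
    by rewrite coprimep_expr.
  have [u' u'E] := redp_surj u.
  exists (quotm_pi _ ((u' * f) *: delta_mx j 0)); rewrite FE.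
  rewrite -scalemxAr -colE mxE mxE mxE -/d.
  apply/eqP; rewrite -subr_eq0 -raddfB; apply/eqP/psi0.
  rewrite rmorphB !rmorphM /= u'E.
  rewrite (_ : _ - _ = - (v * redp p f) * (redp p beta ^+ m)).
    by rewrite dvdp_mull.
  by rewrite -[X in _ - X]mul1r -uv; ring.
elim/quotm_piW => u; rewrite FE => /psi0 /fE[s [r sr]].
have [|b bI] := @coprimep_adic_unit p p_pr beta (e * (d * d)).
  by rewrite !rmorphM /= !coprimepMl eb db.
exists (e * (d * d)), b, (r *: (d *: quotm_pi _ (delta_mx j 0))); split=> //.
rewrite -scalerA coker_adj_ker (scalerA e) sr scalerDl (mulrC phi) -!scalerA.
by rewrite char_poly_coker scaler0 add0r.
Qed.

Lemma Fpx_mod_cyclic (k : {poly 'F_p}) :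
  exists t0 : Fpx_mod k, forall t, exists a : {poly int}, t = a *: t0.
Proof.
have [psi [_ psi_surj]] := Fpx_mod_proj k; exists (psi 1) => t.
have [a <-] := psi_surj t; exists a.
by rewrite -linearZ -[a *: 1]/(a * 1) mulr1.
Qed.

(** A cyclic quotient leaves [M - x] with corank at most one over the residue field
    at [(p, beta)], and then its adjugate is nonzero there. *)
Lemma local_coker_adj (U : lmodType {poly int}) (u0 : U) : (0 < n)%N ->
  beta \is monic -> irreducible_poly (redp p beta) ->
  mod_iso (mod_scale (localize p beta (coker_char M)) p%:R) U ->
  (forall u : U, exists a, u = a *: u0) ->
  exists i j, coprimep (redp p (\adj B i j)) (redp p beta).
Proof.
move=> n0 bm birr iso u0P.
have [|K [rho rho0]] := residue_field _ birr; first exact: monic_map.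
have [|i [j ij]] := @rank_adj_neq0 K n (map_mx rho B) n0.
  apply: (@cyclic_coker_rank _ _ B p%:R beta p%:R K rho _ u0) => //.
  - by apply/eqP; rewrite rho0 redp_nat // dvdp0.
  - by apply/eqP; rewrite rho0.
  - by apply/eqP; rewrite rho0 redp_nat // dvdp0.
exists i, j; rewrite coprimep_sym irreducible_poly_coprime //.
by have := ij; rewrite -map_mx_adj mxE rho0.
Qed.

(** If [p ^+ 2] divided [phi.[a]], row [i] of the adjugate would induce a map from
    the localization to [Z / p ^ 2] taking a value prime to [p], and [p] does not
    kill such a value. *)
Lemma local_coker_not_sq (U : lmodType {poly int}) a i j :
  beta = 'X - a%:P -> coprimep (redp p (\adj B i j)) (redp p beta) ->
  mod_iso (mod_scale (localize p beta (coker_char M)) beta) U ->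
  (forall u : U, p%:R *: u = 0) ->
  ~~ (p%:Z ^+ 2 %| phi.[a])%Z.
Proof.
move=> bE dco iso pU; apply/negP => p2a.
pose S : set {poly int}^o := [set f | (p%:Z ^+ 2 %| f.[a])%Z].
have Sc : submod_closed [pred f | `[< S f >]].
  split=> [|c u v /asboolP uS /asboolP vS]; apply/asboolP; rewrite /S /=.
    by rewrite horner0 dvdz0.
  by rewrite hornerD hornerM rpredD ?dvdz_mull.
(* [T] is [Z / p ^ 2], with the variable acting as [a]. *)
pose T : lmodType {poly int} := quotm S.
pose psi : {linear {poly int}^o -> T} := quotm_pi S.
have psi0 f : psi f = 0 <-> (p%:Z ^+ 2 %| f.[a])%Z.
  by rewrite quotm_pi_eq0 mspan_id.
have killT c : (p%:Z ^+ 2 %| c.[a])%Z -> forall t : T, c *: t = 0.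
  move=> ca; elim/quotm_piW => f; rewrite -linearZ; apply/psi0.
  by rewrite hornerM dvdz_mulr.
have [|F FE] := @coker_adj_lift _ _ B i _ psi.
  move=> f; apply/psi0; rewrite det_coker_char !hornerM.
  by rewrite dvdz_mulr // dvdz_mull.
have gT : forall t : T, p%:R ^+ 2 *: t = 0.
  by apply: killT; rewrite -polyC_natr -rmorphXn hornerC natz.
have hT : forall t : T, beta *: t = 0.
  by apply: killT; rewrite bE !hornerE subrr dvdz0.
have [//|G GE] := @base_change_mod_lift _ p%:R beta (coker_char M) T F 2 1 gT hT beta.
have iso' : mod_iso (quotm [set beta *: t | t in
    [set: tensor (coker B) (adic_completion X)]]) U by exact: iso.
have pkill := mod_iso_kill iso' pU.
have := pkill (quotm_pi _ (pure_tensor (quotm_pi _ (delta_mx j 0))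
  (1 : adic_completion X))).
move=> /(congr1 G); rewrite linear0 linearZ /=.
rewrite (GE _ _ 1) // scale1r FE -linearZ => /psi0.
rewrite -colE mxE mxE hornerM -polyC_natr hornerC natz expr2.
rewrite dvdz_mul2l; last by rewrite -lt0n prime_gt0.
rewrite -intr_Fp_eq0 // -redp_horner => /eqP dva.
have /Bezout_eq1_coprimepP[[u v] /= /(congr1 (fun f => f.[a%:~R]))] := dco.
rewrite hornerD !hornerM hornerC dva redp_horner bE hornerXsubC subrr.
by rewrite !mulr0 addr0 => /esym/eqP; rewrite oner_eq0.
Qed.

End LocalCokernel.

(** * Polynomials over the prime field *)

Section PrimeField.
Variables (p : nat) (p_pr : prime p).
Implicit Types u h : {poly 'F_p}.

(** Only the exponents divisible by [p] occur in [u], and Frobenius fixes the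
    coefficients. *)
Lemma Fp_deriv_eq0 u : u^`() = 0 -> exists w, u = w ^+ p.
Proof.
move=> u'0; have p0 := prime_gt0 p_pr.
have pP : p \in [pchar {poly 'F_p}] by rewrite pchar_poly pchar_Fp.
exists (\poly_(i < size u) u`_(i * p)).
rewrite poly_def -(pFrobenius_autE pP) rmorph_sum /=.
have FE (i : 'I_(size u)) :
    pFrobenius_aut pP (u`_(i * p) *: 'X^i) = u`_(i * p) *: 'X^(i * p).
  rewrite pFrobenius_autE exprZn exprM; congr (_ *: _).
  by have := expf_card u`_(i * p); rewrite card_Fp.
rewrite (eq_bigr _ (fun i _ => FE i)); apply/polyP => j.
rewrite coef_sum; have [/dvdnP[k ->] | pj] := boolP (p %| j)%N; last first.
  rewrite big1 => [|i _]; last first.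
    rewrite coefZ coefXn; case: eqP => [jE|]; last by rewrite mulr0.
    by rewrite jE dvdn_mull in pj.
  have j0 : (0 < j)%N by case: j pj => //; rewrite dvdn0.
  have /eqP := congr1 (fun f : {poly 'F_p} => f`_j.-1) u'0.
  rewrite coef_deriv coef0 prednK // -mulr_natr mulf_eq0 => /orP[/eqP//|].
  by rewrite -(dvdn_pcharf (pchar_Fp p_pr)) (negPf pj).
have [ks|ks] := ltnP k (size u); last first.
  rewrite nth_default ?big1 //; last by apply: leq_trans ks _; apply: leq_pmulr.
  move=> i _; rewrite coefZ coefXn eqn_pmul2r //.
  by case: eqP => [ki|]; [move: ks; rewrite ki leqNgt ltn_ord | rewrite mulr0].
rewrite (bigD1 (Ordinal ks)) //= big1 => [|i ik].
  by rewrite coefZ coefXn eqxx mulr1 addr0.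
rewrite coefZ coefXn eqn_pmul2r // eq_sym.
by case: eqP => [ki|]; [move: ik; rewrite -val_eqE /= ki eqxx | rewrite mulr0].
Qed.

(** A nonconstant factor with zero derivative would be a [p]-th power, hence not
    squarefree; this is where the perfectness of the prime field enters. *)
Lemma Fp_squarefree_separable h :
  (forall u, size u != 1 -> ~~ (u ^+ 2 %| h)) -> separable_poly h.
Proof.
move=> sq; apply/separable_polyP; split; first by apply/poly_square_freeP.
move=> u uh su; apply/eqP => /Fp_deriv_eq0[w uE].
have p1 := prime_gt1 p_pr.
suff /sq : size w != 1.
  case/negP; apply: dvdp_trans uh; rewrite uE.
  exact: dvdp_exp2l.
apply: contraTneq su => /eqP; rewrite size_poly_eq1 => w1.
have : u %= 1 by rewrite uE -(expr1n _ p) eqp_exp.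
by rewrite -size_poly_eq1 => /eqP->.
Qed.

Lemma monic_irreducible_factor (F : fieldType) (u : {poly F}) :
  size u != 1 -> u != 0 ->
  exists d, [/\ d \is monic, irreducible_poly d & d %| u].
Proof.
move=> u1 u0; pose P (k : nat) :=
  `[< exists d : {poly F}, [/\ d %| u, (1 < size d)%N & size d = k] >].
have exP : exists k, P k.
  exists (size u); apply/asboolP; exists u; split=> //.
  by rewrite ltn_neqAle eq_sym u1 size_poly_gt0.
have [k /asboolP[d [du d1 dk]] kmin] := ex_minnP exP.
have d0 : d != 0 by rewrite -size_poly_gt0 ltnW.
have lc : lead_coef d != 0 by rewrite lead_coef_eq0.
have dE : (lead_coef d)^-1 *: d %= d by rewrite eqp_scale // invr_eq0.
exists ((lead_coef d)^-1 *: d); split; last by rewrite (eqp_dvdl _ dE).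
  by rewrite monicE lead_coefZ mulVf.
split=> [|q q1]; first by rewrite (eqp_size dE).
rewrite (eqp_dvdr _ dE) => qd; apply: eqp_trans (_ : q %= d) _; last first.
  by rewrite eqp_sym.
have q0 : q != 0 := dvdpN0 qd d0.
rewrite -dvdp_size_eqp // eqn_leq dvdp_leq //= dk.
apply: kmin; apply/asboolP; exists q; split=> //; first exact: dvdp_trans du.
by rewrite ltn_neqAle eq_sym q1 size_poly_gt0.
Qed.

End PrimeField.

(** * The Sylvester matrix modulo a prime *)

(** The left kernel of the Sylvester matrix consists of the syzygies of [f] and [g]
    of bounded degree. *)
Lemma rVpoly_Sylvester (R : comNzRingType) (f g : {poly R}) v :
  rVpoly (v *m Sylvester_mx f g) = rVpoly (lsubmx v) * f + rVpoly (rsubmx v) * g.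
Proof.
rewrite /Sylvester_mx -[v in LHS]hsubmxK mul_row_col !mul_rV_lin1 /=.
rewrite -linearD poly_rV_K // (leq_trans (size_polyD _ _)) // geq_max.
rewrite !(leq_trans (size_polyMleq _ _)) // -subn1 leq_subLR.
  by rewrite addnC addnA leq_add ?leqSpred ?size_poly.
by rewrite addnCA leq_add ?leqSpred ?size_poly.
Qed.

Section DiscriminantIdeal.
Variable f : {poly int}.
Hypotheses (f_mon : f \is monic) (f_size : (1 < size f)%N).
Local Notation g := (f^`()).

Lemma size_g : size g = (size f).-1.
Proof.
have e : (size f).-2.+1 = (size f).-1 by case: (size f) f_size => [|[|k]].
by rewrite /deriv size_poly_eq // e -lead_coefE (monicP f_mon) -e Num.Theory.pnatr_eq0.
Qed.

Lemma discriminant_ideal : exists u w : {poly int},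
  (discriminant f)%:P = u * f + w * g.
Proof.
have [g1 | g1] := ltnP 1 (size g).
  by have [[u w] _ uw] := resultant_in_ideal f_size g1; exists u, w.
exists 0, (discriminant f)%:P; rewrite mul0r add0r.
suff -> : g = 1 by rewrite mulr1.
have f2 : size f = 2%N.
  by apply/eqP; rewrite eqn_leq f_size andbT; move: g1; rewrite size_g; lia.
have /size1_polyC -> : (size g <= 1)%N by [].
by rewrite coef_deriv mulr1n; have := monicP f_mon; rewrite lead_coefE f2 => ->.
Qed.

End DiscriminantIdeal.

Section Discriminant.
Variables (p : nat) (p_pr : prime p) (f : {poly int}).
Hypotheses (f_mon : f \is monic) (f_size : (1 < size f)%N).
Local Notation g := (f^`()).
Local Notation S := (Sylvester_mx f g).
Local Notation Sp := (map_mx (intr : int -> 'F_p) S).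
Local Notation fp := (redp p f).
Local Notation gp := (redp p g).

Lemma rVpoly_Sylvester_redp v :
  rVpoly (v *m Sp) = rVpoly (lsubmx v) * fp + rVpoly (rsubmx v) * gp.
Proof.
pose v' : 'rV[int]_((size g).-1 + (size f).-1) := \row_k (nat_of_ord (v 0 k))%:Z.
have vE : v = map_mx intr v'.
  by apply/rowP => k; rewrite !mxE -pmulrn natr_Zp.
rewrite vE -map_mxM -map_rVpoly rVpoly_Sylvester rmorphD !rmorphM /=.
by rewrite -map_lsubmx -map_rsubmx -!map_rVpoly.
Qed.

Lemma size_fp : size fp = size f.
Proof. by rewrite size_map_poly_id0 // (monicP f_mon) rmorph1 oner_neq0. Qed.

Lemma fp_neq0 : fp != 0.
Proof. by rewrite -size_poly_eq0 size_fp -lt0n ltnW. Qed.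

Lemma redp_g : gp = fp^`().
Proof. by rewrite deriv_map. Qed.

Lemma Sylvester_kernel v : v *m Sp = 0 ->
  rVpoly (lsubmx v) * fp + rVpoly (rsubmx v) * gp = 0.
Proof. by rewrite -rVpoly_Sylvester_redp => ->; rewrite linear0. Qed.

Lemma Sylvester_kernel_row (u w : {poly 'F_p}) :
  (size u <= (size g).-1)%N -> (size w <= (size f).-1)%N -> u * fp + w * gp = 0 ->
  row_mx (poly_rV u) (poly_rV w) *m Sp = 0.
Proof.
move=> su sw uw; apply: (can_inj rVpolyK); rewrite rVpoly_Sylvester_redp.
by rewrite row_mxKl row_mxKr !poly_rV_K // uw linear0.
Qed.

End Discriminant.

(** * Primes exactly dividing the discriminant *)

Lemma horner_taylor1 (R : comNzRingType) (f : {poly R}) a t :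
  exists r, f.[a + t] = f.[a] + t * f^`().[a] + t ^+ 2 * r.
Proof.
elim/poly_ind: f => [|q c [r IH]]; first by exists 0; rewrite deriv0 !horner0; ring.
exists (q^`().[a] + r * (a + t)).
by rewrite !derivE !hornerE IH; ring.
Qed.

Lemma deriv_double_root (R : comNzRingType) (a : R) h :
  (('X - a%:P) ^+ 2 * h)^`() = ('X - a%:P) * (h + h + ('X - a%:P) * h^`()).
Proof. by rewrite derivM expr2 derivM derivXsubC; ring. Qed.

Lemma redp_XsubC p a : redp p ('X - a%:P) = 'X - (a%:~R)%:P.
Proof. exact: map_polyXsubC. Qed.

Section Arithmetic.
Variables (p : nat) (p_pr : prime p).

Lemma Fp_two_neq0 : odd p -> (2%:R : 'F_p) != 0.
Proof.
move=> p_odd.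
rewrite -(dvdn_pcharf (pchar_Fp p_pr)) gtnNdvd // ltn_neqAle prime_gt1 // andbT.
by apply: contraTneq p_odd => <-.
Qed.

Lemma exactly_divides_det_adj N (S : 'M[int]_N) : exactly_divides p (\det S) ->
  exists i j, \adj (map_mx (intr : int -> 'F_p) S) i j != 0.
Proof.
case/andP => /dvdzP[e eE] p2.
apply: contrapT => adj0; case/negP: p2; rewrite eE expr2.
have pN : p%:Z != 0 by rewrite -lt0n prime_gt0.
have adjE : \adj S = p%:Z *: map_mx (fun z => (z %/ p)%Z) (\adj S).
  apply/matrixP => i j; rewrite [RHS]mxE [X in _ * X]mxE mulrC divzK //.
  rewrite -intr_Fp_eq0 //; apply: contrapT => /negP nz; apply: adj0; exists i, j.
  by rewrite -map_mx_adj mxE.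
rewrite dvdz_mul2r //.
have := adj_not_divisible pN (etrans eE (mulrC _ _)) adjE.
move/(congr1 (fun z : int => (p %| z)%Z)).
rewrite mulrCA dvdz_mulr // -intr_Fp_eq0 // rmorphXn expf_eq0 => /andP[_].
by rewrite intr_Fp_eq0.
Qed.

Variable f : {poly int}.
Hypotheses (f_mon : f \is monic) (f_size : (1 < size f)%N).
Local Notation g := (f^`()).
Local Notation Sp := (map_mx (intr : int -> 'F_p) (Sylvester_mx f g)).
Local Notation fp := (redp p f).
Local Notation gp := (redp p g).

(** Modulo [p], the only multiple factor of [f] is a double root at [a]. The last
    clause does not depend on the lift [a], as [p] divides [f^`().[a]]; it says
    that this root has no lift modulo [p ^ 2]. *)
Definition simple_double_root (a : int) : Prop :=
  [/\ exists2 h, fp = ('X - (a%:~R)%:P) ^+ 2 * h & ~~ root h a%:~R,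
      forall b : {poly 'F_p}, b \is monic -> irreducible_poly b ->
        b != 'X - (a%:~R)%:P -> ~~ (b ^+ 2 %| fp)
    & ~~ (p%:Z ^+ 2 %| f.[a])%Z].

(** One step of Hensel's lemma for [a], which is a simple root of [f^`()] modulo
    [p] because [2 * h.[a]] is nonzero. Moving [a] by a multiple of [p] does not
    change [f.[a]] modulo [p ^ 2], because [p] divides [f^`().[a]]. *)
Lemma deriv_root_lift a h : odd p -> fp = ('X - (a%:~R)%:P) ^+ 2 * h ->
  ~~ root h a%:~R ->
  exists b, [/\ (p %| b - a)%Z, (p%:Z ^+ 2 %| g.[b])%Z
              & (p%:Z ^+ 2 %| f.[b])%Z = (p%:Z ^+ 2 %| f.[a])%Z].
Proof.
move=> p_odd fpE ha.
have p2 := Fp_two_neq0 p_odd.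
have g0 : (g.[a]%:~R : 'F_p) = 0.
  by rewrite -redp_horner redp_g fpE deriv_double_root hornerM hornerXsubC subrr mul0r.
have g1 : (g^`().[a]%:~R : 'F_p) != 0.
  rewrite -redp_horner !redp_g fpE deriv_double_root derivM derivXsubC mul1r.
  rewrite !hornerD !hornerM hornerXsubC subrr !mul0r !addr0 -mulr2n.
  by rewrite -mulr_natr mulf_neq0.
have /dvdzP[c cE] : (p %| g.[a])%Z by rewrite -intr_Fp_eq0 // g0.
pose t : int := (nat_of_ord (- c%:~R / g^`().[a]%:~R : 'F_p))%:Z.
have tE : (t%:~R : 'F_p) = - c%:~R / g^`().[a]%:~R by rewrite -pmulrn natr_Zp.
have p22 : (p%:Z ^+ 2 = p%:Z * p%:Z) by rewrite expr2.
exists (a + t * p%:Z); split.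
- by rewrite addrC addKr dvdz_mull.
- have [r ->] := horner_taylor1 g a (t * p%:Z).
  have -> : g.[a] + t * p * g^`().[a] + (t * p) ^+ 2 * r
    = (c + t * g^`().[a]) * p + (t ^+ 2 * r) * p ^+ 2 by rewrite cE; ring.
  apply: rpredD; last exact: dvdz_mull.
  rewrite p22; apply: dvdz_mul => //; rewrite -intr_Fp_eq0 //.
  by rewrite rmorphD rmorphM /= tE divfK // subrr.
have [r ->] := horner_taylor1 f a (t * p%:Z).
have -> : f.[a] + t * p%:Z * g.[a] + (t * p%:Z) ^+ 2 * r
    = f.[a] + (t * c + t ^+ 2 * r) * p%:Z ^+ 2 by rewrite cE; ring.
by rewrite rpredDr // dvdz_mull.
Qed.

(** If [fp = F1 * G] and [gp = G1 * G], then [(- G1, F1)] is in the left kernel of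
    the Sylvester matrix, and so is its product with the variable as soon as [G] has
    degree at least two. The exact divisibility makes this kernel a line. *)
Lemma size_gcdp_deriv : exactly_divides p (discriminant f) ->
  size (gcdp fp gp) = 2%N.
Proof.
move=> pd; have [i0 [j0 /adj_neq0_rank rS]] := exactly_divides_det_adj pd.
have f0 : fp != 0 := fp_neq0 p f_mon f_size.
have sf := size_fp p f_mon; have sg := size_g f_mon f_size.
set G := gcdp fp gp; have G0 : G != 0 by rewrite gcdp_eq0 negb_and f0.
have /dvdpP[F1 F1E] : G %| fp := dvdp_gcdl _ _.
have /dvdpP[G1 G1E] : G %| gp := dvdp_gcdr _ _.
have F10 : F1 != 0 by apply: contraNneq f0 => F10; rewrite F1E F10 mul0r.
have sF1 : (size F1 + size G = (size f).+1)%N.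
  by rewrite -sf F1E size_mul // prednK // addn_gt0 size_poly_gt0 F10.
have sG1 : (size G1 + size G <= (size g).+1)%N \/ G1 = 0.
  have [->|G10] := eqVneq G1 0; [by right | left].
  have -> : (size G1 + size G = (size gp).+1)%N.
    by rewrite G1E size_mul // prednK // addn_gt0 size_poly_gt0 G10.
  by rewrite ltnS /redp /map_poly size_poly.
have G1gt : (1 < size G)%N.
  rewrite ltnNge; apply/negP => sG1'.
  have co : coprimep fp gp by rewrite coprimep_def eqn_leq sG1' size_poly_gt0.
  have /det0P[v v0 vS] : \det Sp == 0.
    by case/andP: pd; rewrite -intr_Fp_eq0 // det_map_mx.
  have := Sylvester_kernel vS; set u := rVpoly _; set w := rVpoly _ => uw.
  have w0 : w = 0.
    apply: contraTeq (size_poly _ _ : (size w <= (size f).-1)%N) => w0.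
    rewrite -ltnNge prednK ?(ltnW f_size) // -sf dvdp_leq //.
    rewrite -(Gauss_dvdpl _ co) -(dvdp_addr _ (dvdp_mull u (dvdpp fp))).
    by rewrite uw dvdp0.
  have u0 : u = 0.
    by move/eqP: uw; rewrite w0 mul0r addr0 mulf_eq0 (negPf f0) orbF => /eqP.
  case/eqP: v0; rewrite -[v]hsubmxK.
  have -> : lsubmx v = 0 by rewrite -[lsubmx v]rVpolyK -/u u0 linear0.
  have -> : rsubmx v = 0 by rewrite -[rsubmx v]rVpolyK -/w w0 linear0.
  by rewrite row_mx0.
apply/eqP; rewrite eqn_leq G1gt andbT leqNgt; apply/negP => G3.
have room (x y z : nat) : (x + y <= z.+1 -> 2 < y -> x < z.-1)%N by lia.
have sizeMX (q : {poly 'F_p}) : (size (q * 'X)%R <= (size q).+1)%N.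
  by apply: leq_trans (size_polyMleq _ _) _; rewrite size_polyX addn2.
pose v1 : 'rV_((size g).-1 + (size f).-1) := row_mx (poly_rV (- G1)) (poly_rV F1).
pose v2 : 'rV_((size g).-1 + (size f).-1) :=
  row_mx (poly_rV (- (G1 * 'X))) (poly_rV (F1 * 'X)).
have v1S : v1 *m Sp = 0.
  apply: Sylvester_kernel_row.
  - rewrite size_polyN; case: sG1 => [sG|->]; last by rewrite size_poly0.
    exact: ltnW (room _ _ _ sG G3).
  - exact: ltnW (room _ _ _ (eq_leq sF1) G3).
  by rewrite F1E G1E; ring.
have v2S : v2 *m Sp = 0.
  apply: Sylvester_kernel_row.
  - rewrite size_polyN; case: sG1 => [sG|->]; last by rewrite mul0r size_poly0.
    exact: leq_trans (sizeMX _) (room _ _ _ sG G3).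
  - exact: leq_trans (sizeMX _) (room _ _ _ (eq_leq sF1) G3).
  by rewrite F1E G1E; ring.
have rF : rVpoly (rsubmx v1) = F1.
  by rewrite row_mxKr poly_rV_K // (ltnW (room _ _ _ (eq_leq sF1) G3)).
have v10 : v1 != 0.
  by apply: contraNneq F10 => v10; rewrite -rF v10 linear0 linear0.
have k1 : (v1 <= kermx Sp)%MS by apply/sub_kermxP.
have k2 : (v2 <= kermx Sp)%MS by apply/sub_kermxP.
have : (kermx Sp <= v1)%MS.
  rewrite -(geq_leqif (mxrank_leqif_sup k1)) mxrank_ker rank_rV v10.
  by rewrite leq_subLR addn1.
move/(submx_trans k2)/sub_rVP => [c /(congr1 (fun v => rVpoly (rsubmx v)))].
rewrite !linearZ /= rF row_mxKr poly_rV_K; last first.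
  exact: leq_trans (sizeMX _) (room _ _ _ (eq_leq sF1) G3).
rewrite -mul_polyC mulrC => /(mulIf F10) /(congr1 (fun q : {poly 'F_p} => size q)).
by rewrite size_polyX size_polyC; case: (c != 0).
Qed.

(** The linear common factor of [fp] and [gp] is the double root [a]. If [p ^+ 2]
    divided [f.[a]], then [f] and [f^`()] would have a common root modulo [p ^ 2],
    and [p ^+ 2] would divide the discriminant, which is a combination of both. *)
Lemma exactly_divides_double_root : odd p -> exactly_divides p (discriminant f) ->
  exists a, simple_double_root a.
Proof.
move=> p_odd pd; have sG := size_gcdp_deriv pd; set G := gcdp fp gp in sG.
have G0 : G != 0 by rewrite -size_poly_eq0 sG.
have [x] := poly2_root sG; pose a : int := (nat_of_ord x)%:Z.
have -> : x = a%:~R by rewrite -pmulrn natr_Zp.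
move=> Ga; have XG : 'X - (a%:~R)%:P %| G by rewrite dvdp_XsubCl.
have [k fE] : exists k, fp = k * ('X - (a%:~R)%:P).
  by apply/dvdpP; apply: dvdp_trans XG (dvdp_gcdl _ _).
have [h kE] : exists h, k = h * ('X - (a%:~R)%:P).
  apply/dvdpP; rewrite dvdp_XsubCl; have := dvdp_trans XG (dvdp_gcdr _ _).
  rewrite redp_g fE derivM derivXsubC mulr1 dvdp_addr ?dvdp_mull //.
  by rewrite dvdp_XsubCl.
have fpE : fp = ('X - (a%:~R)%:P) ^+ 2 * h by rewrite fE kE; ring.
have XeqG : 'X - (a%:~R)%:P %= G by rewrite -dvdp_size_eqp // size_XsubC sG.
have ha : ~~ root h a%:~R.
  apply/negP => /factor_theorem[l hE].
  have : ('X - (a%:~R)%:P) ^+ 2 %| G.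
    rewrite dvdp_gcd fpE dvdp_mulr ?redp_g ?fpE ?deriv_double_root //.
    rewrite expr2; apply: dvdp_mul => //; rewrite {1 2}hE.
    by apply: dvdp_add; [apply: dvdp_add; apply: dvdp_mull | apply: dvdp_mulr].
  by move/(dvdp_leq G0); rewrite sG size_exp_XsubC.
exists a; split; first by exists h.
- move=> b bm birr bX; apply/negP => /dvdpP[q qE].
  have bG : b %| G.
    rewrite dvdp_gcd redp_g qE expr2 mulrA dvdp_mull //= derivM.
    by apply: dvdp_add; [apply: dvdp_mull | apply: dvdp_mulr; apply: dvdp_mull].
  have : b %= 'X - (a%:~R)%:P.
    rewrite eqp_sym (eqp_ltrans XeqG) eqp_sym -dvdp_size_eqp // sG.
    by rewrite eqn_leq (leq_trans (dvdp_leq G0 bG)) ?sG //= birr.1.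
  by rewrite eqp_monic ?monicXsubC // (negPf bX).
apply/negP => p2f.
have [b [_ gb fb]] := deriv_root_lift p_odd fpE ha.
have [u [w uw]] := discriminant_ideal f_mon f_size.
case/andP: pd => _ /negP[].
rewrite -[discriminant f](hornerC _ b) uw hornerD !hornerM.
by rewrite rpredD // dvdz_mull // fb.
Qed.

(** Write [fp = (X - a) * F1] and [gp = (X - a) * G1]. As [F1] and [G1] are coprime,
    the only syzygies in the degrees of the Sylvester matrix are the multiples of
    [(- G1, F1)]; and [K = - G1] does not vanish at [a], its value there being
    [- 2 * h.[a]]. *)
Lemma double_root_kernel a : odd p -> simple_double_root a ->
  exists K v0, ~~ root K a%:~R /\ forall v, v *m Sp = 0 ->
    exists2 c, v = c *: v0 & rVpoly (lsubmx v) = c *: K.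
Proof.
move=> p_odd [[h fpE ha] sq _].
set L := 'X - (a%:~R)%:P in fpE sq.
have p2 := Fp_two_neq0 p_odd.
pose F1 := L * h; pose G1 := h + h + L * h^`().
have fpF : fp = F1 * L by rewrite fpE /F1; ring.
have gpG : gp = G1 * L by rewrite redp_g fpE deriv_double_root mulrC.
have h0 : h != 0 by apply: contraNneq ha => ->; rewrite root0.
have L0 : L != 0 by rewrite polyXsubC_eq0.
have F10 : F1 != 0 by rewrite mulf_neq0.
have G1a : ~~ root G1 a%:~R.
  rewrite rootE /G1 /L !hornerD hornerM hornerXsubC subrr mul0r addr0 -mulr2n.
  by rewrite -mulr_natr mulf_neq0.
have h_sep : separable_poly h.
  apply: (Fp_squarefree_separable p_pr) => u u1; apply/negP => u2h.
  have u0 : u != 0 by apply: contraTneq u2h => ->; rewrite expr2 mul0r dvd0p.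
  have [d [dm dirr du]] := monic_irreducible_factor u1 u0.
  have d2h : d ^+ 2 %| h by apply: dvdp_trans u2h; rewrite !expr2 dvdp_mul.
  have [dL | dL] := eqVneq d L.
    case/negP: ha; rewrite -dvdp_XsubCl -/L -dL.
    by apply: dvdp_trans d2h; apply: dvdp_mulr.
  by case/negP: (sq d dm dirr dL); rewrite fpE dvdp_mull.
have coF : coprimep F1 G1.
  rewrite /F1 coprimepMl coprimep_sym coprimep_XsubC G1a /= /G1.
  rewrite -mulr2n -mulr_natl coprimep_addl_mul coprimepMr coprimep_XsubC ha /=.
  by move: h_sep; rewrite unlock.
have sF : size F1 = (size f).-1.
  have sFL : size (F1 * L)%R = (size F1).+1.
    by rewrite size_Mmonic ?monicXsubC // size_XsubC addn2.
  by rewrite -(size_fp p f_mon) fpF sFL.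
exists (- G1), (row_mx (poly_rV (- G1)) (poly_rV F1)); split; first by rewrite rootN.
move=> v /Sylvester_kernel.
set u := rVpoly (lsubmx v); set w := rVpoly (rsubmx v) => uw.
have uFwG : u * F1 + w * G1 = 0.
  by apply: (mulIf L0); rewrite mul0r -uw fpF gpG; ring.
have /dvdpP[q wE] : F1 %| w.
  rewrite -(Gauss_dvdpl _ coF) -(dvdp_addr _ (dvdp_mull u (dvdpp F1))).
  by rewrite uFwG dvdp0.
have q1 : (size q <= 1)%N.
  have [->|q0] := eqVneq q 0; first by rewrite size_poly0.
  have := size_poly _ _ : (size w <= (size f).-1)%N.
  rewrite wE size_mul // -sF => le_q.
  have room (x y : nat) : (0 < y -> (x + y).-1 <= y -> x <= 1)%N by lia.
  by apply: room le_q; rewrite size_poly_gt0.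
move: wE; rewrite (size1_polyC q1) mul_polyC; set c := q`_0 => wE.
have uE : u = c *: - G1.
  apply: (mulIf F10); apply/eqP; rewrite -subr_eq0 -uFwG wE -!mul_polyC.
  by apply/eqP; ring.
exists c => //; rewrite -[LHS]hsubmxK -[lsubmx v]rVpolyK -[rsubmx v]rVpolyK.
by rewrite -/u -/w uE wE !linearZ -scale_row_mx.
Qed.

(** If [p ^+ 2] divided the determinant of the Sylvester matrix, a row of its
    adjugate would be a relation [U * f + W * f^`() = 0] modulo [p ^ 2] that is
    nonzero modulo [p]. At the lifted root [b] of [f^`()], the description of the
    kernel makes [U.[b]] prime to [p], and so [p ^+ 2] would divide [f.[b]]. *)
Lemma double_root_exactly_divides a : odd p -> simple_double_root a ->
  exactly_divides p (discriminant f).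
Proof.
move=> p_odd a_root; have [K [v0 [Ka kerS]]] := double_root_kernel p_odd a_root.
have [[h fpE ha] _ p2f] := a_root.
apply/andP; split.
  have [u [w uw]] := discriminant_ideal f_mon f_size.
  rewrite -intr_Fp_eq0 // -[discriminant f](hornerC _ a) uw -redp_horner.
  rewrite rmorphD !rmorphM /= redp_g fpE deriv_double_root hornerD !hornerM.
  by rewrite !hornerXsubC !subrr !mul0r !mulr0 addr0.
apply/negP => p2d; have [b [ba gb fb]] := deriv_root_lift p_odd fpE ha.
case/negP: p2f; rewrite -fb.
have rk : ((size g).-1 + (size f).-1 <= (\rank Sp).+1)%N.
  have kv0 : (kermx Sp <= v0)%MS.
    apply/row_subP => i; have [|c -> _] := kerS (row i (kermx Sp)).
      by rewrite -row_mul mulmx_ker row0.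
    exact: scalemx_sub.
  have := leq_trans (mxrankS kv0) (rank_leq_row v0).
  by rewrite mxrank_ker leq_subLR addn1.
have N0 : (0 < (size g).-1 + (size f).-1)%N.
  by case: (size f) f_size => [|[|m]] // _; rewrite addnS.
have [i [j ij]] := rank_adj_neq0 N0 rk.
set S := Sylvester_mx f g in ij *; pose v := row i (\adj S).
have vS : v *m S = discriminant f *: delta_mx 0 i.
  by rewrite /v -row_mul mul_adj_mx -scalemx1 linearZ /= row1.
have [|c vE uE] := kerS (map_mx intr v).
  rewrite -map_mxM vS map_mxZ /=.
  by move: p2d; rewrite expr2 => /(dvdz_trans (dvdz_mulr _ (dvdzz _)));
    rewrite -intr_Fp_eq0 // => /eqP->; rewrite scale0r.
have c0 : c != 0.
  apply: contraNneq ij => c0; have /rowP/(_ j) := vE.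
  by rewrite c0 scale0r [RHS]mxE => <-; rewrite -map_mx_adj /v map_row [X in _ == X]mxE.
set U := rVpoly (lsubmx v).
have UE : redp p U = c *: K by rewrite -uE /U -map_lsubmx -map_rVpoly.
have Ub : ~~ (p %| U.[b])%Z.
  rewrite -intr_Fp_eq0 // -redp_horner.
  have -> : (b%:~R : 'F_p) = a%:~R.
    by apply/eqP; rewrite -subr_eq0 -rmorphB /= intr_Fp_eq0.
  by rewrite UE hornerZ mulf_neq0.
have : (p%:Z ^+ 2 %| U.[b] * f.[b])%Z.
  have /(congr1 (fun q : {poly int} => q.[b])) := @rVpoly_Sylvester _ f g v.
  rewrite vS linearZ hornerZ hornerD !hornerM -/U => /esym e.
  rewrite -[X in (_ %| X)%Z](addrK ((rVpoly (rsubmx v)).[b] * g.[b])) e.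
  by apply: rpredB; [apply: dvdz_mulr | apply: dvdz_mull].
by rewrite Gauss_dvdzr // coprimezXl // coprimezE prime_coprime.
Qed.

End Arithmetic.

(** * Comparison of the two conditions *)

Lemma irreducible_multiplicity (F : fieldType) (b f : {poly F}) :
  irreducible_poly b -> f != 0 ->
  exists m k, f = b ^+ m * k /\ coprimep b k.
Proof.
move=> birr; have [n] := ubnP (size f); elim: n f => // n IH f fn f0.
have [/dvdpP[q qE] | bf] := boolP (b %| f); last first.
  by exists 0%N, f; rewrite expr0 mul1r irreducible_poly_coprime.
have q0 : q != 0 by apply: contraNneq f0 => q0; rewrite qE q0 mul0r.
have [|m [k [kE bk]]] := IH q _ q0.
  rewrite -ltnS; apply: leq_trans fn; rewrite ltnS qE (size_mul q0 (irredp_neq0 birr)).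
  by case: (size b) birr.1 => [|[|s]] // _; rewrite !addnS /= ltnS leq_addr.
by exists m.+1, k; split=> //; rewrite qE kE exprS; ring.
Qed.

Lemma redp_surj_monic p (b : {poly 'F_p}) : b \is monic ->
  exists2 beta, redp p beta = b & beta \is monic.
Proof.
move=> bm; have b0 := monic_neq0 bm.
pose r := b - 'X^((size b).-1).
pose d := \poly_(i < (size b).-1) ((nat_of_ord r`_i)%:Z).
have sd : (size d < size ('X^((size b).-1) : {poly int}))%N.
  by rewrite size_polyXn ltnS size_poly.
exists ('X^((size b).-1) + d); last first.
  by rewrite monicE lead_coefDl // lead_coefXn.
rewrite rmorphD rmorphXn /= [redp p 'X]map_polyX.
suff -> : redp p d = r by rewrite /r addrC subrK.
apply/polyP => i; rewrite coef_map coef_poly; case: ltnP => [_|ib] /=.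
  by rewrite -pmulrn natr_Zp.
rewrite rmorph0 /r coefB coefXn; move: ib; rewrite leq_eqVlt => /predU1P[<-|ib].
  by rewrite eqxx -lead_coefE (monicP bm) subrr.
rewrite gtn_eqF // subr0 nth_default //.
by rewrite -(prednK (_ : 0 < size b)%N) // size_poly_gt0.
Qed.

Section Local.
Variables (n : nat) (n_gt0 : (0 < n)%N) (M : 'M[int]_n) (p : nat) (p_pr : prime p).
Local Notation B := (map_mx polyC M - ('X%:M : 'M[{poly int}]_n)).
Local Notation phi := (char_poly M).

Lemma local_coker_mod_p beta m k i j :
  redp p phi = redp p beta ^+ m * k -> coprimep (redp p beta) k ->
  coprimep (redp p (\adj B i j)) (redp p beta) ->
  mod_iso (mod_scale (localize p beta (coker_char M)) p%:R)
          (Fpx_mod (redp p beta ^+ m)).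
Proof.
move=> phiE bk adj_b; have [e eE] := redp_surj k.
apply: (local_coker_cyclic p_pr (e := e) adj_b).
- by rewrite eE coprimep_sym.
- by rewrite phiE dvdp_mulr.
- by rewrite redp_nat // dvdp0.
move=> f /dvdpP[q fE]; apply: redp_dvdp => //.
rewrite phiE rmorphM /= eE fE (_ : k * _ = q * (redp p beta ^+ m * k)).
  exact: dvdp_mull.
by ring.
Qed.

(** If [beta] divided the whole adjugate, comparing determinants as in
    [adj_not_divisible] would make it divide a power of [k]. *)
Lemma adj_coprime_simple beta k : irreducible_poly (redp p beta) ->
  redp p phi = redp p beta * k -> coprimep (redp p beta) k ->
  exists i j, coprimep (redp p (\adj B i j)) (redp p beta).
Proof.
move=> birr phiE bk; apply: contrapT => adj_nb.
pose Bp := map_mx (redp p) B.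
have detBp : \det Bp = redp p beta * ((-1) ^+ n * k).
  rewrite det_map_mx det_coker_char rmorphM rmorphXn rmorphN1 /= phiE.
  by rewrite mulrCA.
have adjE : \adj Bp = redp p beta *: map_mx (fun q => q %/ redp p beta) (\adj Bp).
  apply/matrixP => i j; rewrite [RHS]mxE [X in _ * X]mxE mulrC divpK //.
  apply: contrapT => /negP nb; apply: adj_nb; exists i, j.
  rewrite coprimep_sym irreducible_poly_coprime //.
  by move: nb; rewrite /Bp -map_mx_adj mxE.
have := adj_not_divisible (irredp_neq0 birr) detBp adjE.
move/(congr1 (fun q => redp p beta %| q)).
rewrite dvdp_mull ?dvdp_mulr //.
have : coprimep (redp p beta) (((-1) ^+ n * k) ^+ n).
  apply: coprimep_expr; rewrite coprimepMr bk andbT.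
  rewrite -signr_odd; case: (odd n); rewrite ?coprimep1 // expr1 -scaleN1r.
  by rewrite coprimepZr ?oppr_eq0 ?oner_eq0 ?coprimep1.
by rewrite irreducible_poly_coprime // => /negbTE ->.
Qed.

(** The integer matrix [M - a] has determinant [phi.[a]] up to sign, so [p] cannot
    divide its whole adjugate. *)
Lemma adj_coprime_root a : exactly_divides p phi.[a] ->
  exists i j, coprimep (redp p (\adj B i j)) (redp p ('X - a%:P)).
Proof.
move=> pa; pose Ba := map_mx (horner_eval a) B.
have detBa : \det Ba = (-1) ^+ n * phi.[a].
  by rewrite det_map_mx det_coker_char /= horner_evalE hornerM horner_exp !hornerE.
have [|i [j ij]] := @exactly_divides_det_adj p p_pr n Ba.
  move: pa; rewrite /exactly_divides detBa -signr_odd.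
  by case: (odd n); rewrite ?expr1 ?expr0 ?mul1r // mulN1r !rpredN.
exists i, j; rewrite redp_XsubC coprimep_XsubC rootE redp_horner.
by move: ij; rewrite -!map_mx_adj !mxE.
Qed.

(** Modulo [x - a], the cokernel is killed by [phi.[a] = e * p], where [e] is
    invertible at [(p, x - a)]. *)
Lemma local_coker_mod_root a i j : exactly_divides p phi.[a] ->
  coprimep (redp p (\adj B i j)) (redp p ('X - a%:P)) ->
  mod_iso (mod_scale (localize p ('X - a%:P) (coker_char M)) ('X - a%:P))
          (Fpx_mod (redp p ('X - a%:P))).
Proof.
move=> /andP[/dvdzP[e eE] p2] adj_b.
change (mod_iso (mod_scale (localize p ('X - a%:P) (coker_char M)) ('X - a%:P))
  (Fpx_mod (redp p ('X - a%:P) ^+ 1))).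
have pe : ~~ (p %| e)%Z.
  by apply: contraNN p2 => pe; rewrite eE expr2 dvdz_mul.
have [s sE] : exists s, phi = s * ('X - a%:P) + (phi.[a])%:P.
  have /factor_theorem[s sE] : root (phi - (phi.[a])%:P) a.
    by rewrite rootE hornerD hornerN hornerC subrr.
  by exists s; rewrite -sE subrK.
apply: (local_coker_cyclic p_pr (e := e%:P) adj_b).
- rewrite redp_XsubC coprimep_XsubC rootE redp_horner hornerC.
  by rewrite intr_Fp_eq0.
- rewrite expr1 redp_XsubC dvdp_XsubCl rootE redp_horner intr_Fp_eq0 // eE.
  exact: dvdz_mull.
- by [].
rewrite expr1 => f /(redp_dvdp p_pr)[q [r ->]].
exists r, (e%:P * q - s * r).
by rewrite sE eE rmorphM /= -natz polyC_natr; ring.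
Qed.

(** The multiplicity of [beta] in [phi] can be read off from a cyclic
    [V_(p, beta) / p]. *)
Lemma local_coker_multiplicity beta m k (U : lmodType {poly int}) (u0 : U) :
  beta \is monic -> irreducible_poly (redp p beta) ->
  redp p phi = redp p beta ^+ m * k -> coprimep (redp p beta) k ->
  mod_iso (mod_scale (localize p beta (coker_char M)) p%:R) U ->
  (forall u : U, exists a, u = a *: u0) ->
  mod_iso (Fpx_mod (redp p beta ^+ m)) U.
Proof.
move=> bm birr phiE bk iso u0P.
have [i [j ij]] := local_coker_adj p_pr n_gt0 bm birr iso u0P.
exact: mod_iso_trans (mod_iso_sym (local_coker_mod_p phiE bk ij)) iso.
Qed.

End Local.

Theorem proposition3p10 (n : nat) (hn : (0 < n)%N) (M : 'M[int]_n)
    (p : nat) (hp : prime p) (hp2 : odd p) :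
  exactly_divides p (discriminant (char_poly M)) <->
  exists a : int,
    (forall beta : {poly int}, beta \is monic ->
       irreducible_poly (redp p beta) ->
       redp p beta <> redp p ('X - a%:P) ->
       mod_iso (mod_scale (localize p beta (coker_char M)) p%:R) zero_mod \/
       mod_iso (mod_scale (localize p beta (coker_char M)) p%:R)
               (Fpx_mod (redp p beta))) /\
    (mod_iso (mod_scale (localize p ('X - a%:P) (coker_char M)) p%:R)
             (Fpx_mod (redp p ('X - a%:P) ^+ 2)) /\
     mod_iso (mod_scale (localize p ('X - a%:P) (coker_char M)) ('X - a%:P))
             (Fpx_mod (redp p ('X - a%:P)))).
Proof.
have phi_mon := char_poly_monic M.
have phi_size : (1 < size (char_poly M))%N by rewrite size_char_poly.
have zero_modE (t : zero_mod) : t = 0 by apply: flatmx0.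
split=> [/(exactly_divides_double_root hp phi_mon phi_size hp2)[a]|].
  case=> -[h phiE ha] sq p2; exists a.
  have pa : exactly_divides p (char_poly M).[a].
    rewrite /exactly_divides p2 andbT -intr_Fp_eq0 // -redp_horner phiE.
    by rewrite hornerM horner_exp hornerXsubC subrr expr2 !mul0r.
  have [i [j ij]] := adj_coprime_root hp pa.
  split; [|split; last exact: (local_coker_mod_root hp pa ij)]; last first.
    apply: (local_coker_mod_p (k := h) hp _ _ ij); rewrite redp_XsubC //.
    by rewrite coprimep_sym coprimep_XsubC.
  move=> beta bm birr; rewrite redp_XsubC => /eqP bX.
  have [bphi | nbphi] := boolP (redp p beta %| redp p (char_poly M)); last first.
    left; apply: (local_coker_zero hp) => //.
    by rewrite coprimep_sym irreducible_poly_coprime.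
  right; have [k kE] := dvdpP _ _ bphi.
  have bk : coprimep (redp p beta) k.
    rewrite irreducible_poly_coprime //; apply/negP => bk.
    case/negP: (sq _ (monic_map _ bm) birr bX).
    by rewrite expr2 kE dvdp_mul.
  rewrite mulrC in kE; have [i' [j' ij']] := adj_coprime_simple birr kE bk.
  by apply: (local_coker_mod_p (m := 1) hp _ bk ij'); rewrite expr1.
case=> a [beta_iso [iso2 iso1]].
apply: (double_root_exactly_divides hp phi_mon phi_size (a := a) hp2).
have X_irr : irreducible_poly (redp p ('X - a%:P)).
  by rewrite redp_XsubC; apply: irredp_XsubC.
have fp0 := fp_neq0 p phi_mon phi_size.
have [t0 t0P] := Fpx_mod_cyclic (redp p ('X - a%:P) ^+ 2).
have [i [j ij]] := local_coker_adj hp hn (monicXsubC a) X_irr iso2 t0P.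
split.
- have [m [h [phiE bh]]] := irreducible_multiplicity X_irr fp0.
  have := local_coker_multiplicity hn hp (monicXsubC a) X_irr phiE bh iso2 t0P.
  move=> isom; have := Fpx_mod_iso_dvdp isom.
  have := Fpx_mod_iso_dvdp (mod_iso_sym isom).
  rewrite redp_XsubC in phiE bh *; rewrite !dvdp_Pexp2l ?size_XsubC // => le1 le2.
  have m2 : m = 2%N by apply/eqP; rewrite eqn_leq le1.
  exists h; first by rewrite phiE m2.
  by rewrite -coprimep_XsubC coprimep_sym.
- move=> b bm birr bX; apply/negP => b2.
  have [beta bE beta_mon] := redp_surj_monic bm.
  have [m [k [phiE bk]]] := irreducible_multiplicity birr fp0.
  have m2 : (1 < m)%N.
    rewrite ltnNge; apply/negP => m1.
    have : b ^+ 2 %| b ^+ m by rewrite -(Gauss_dvdpl _ (coprimep_expl 2 bk)) -phiE.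
    by rewrite dvdp_Pexp2l ?birr.1 // leqNgt ltnS m1.
  rewrite -bE in birr phiE bk bX b2.
  have [|iso|iso] := beta_iso beta beta_mon birr.
  - by apply/eqP; rewrite redp_XsubC.
  - have [u0 u0P] : exists u0 : zero_mod, forall u, exists c : {poly int}, u = c *: u0.
      by exists 0 => u; exists 0; rewrite [LHS]zero_modE [RHS]zero_modE.
    have isom := local_coker_multiplicity hn hp beta_mon birr phiE bk iso u0P.
    have kill : forall t : Fpx_mod (redp p beta ^+ m), (1 : {poly int}) *: t = 0.
      by apply: mod_iso_kill isom _ => t; apply: zero_modE.
    have := (Fpx_mod_ann _ _).1 kill; rewrite rmorph1.
    rewrite -[1](expr0 (redp p beta)) dvdp_Pexp2l ?birr.1 //.
    by case: m m2 {phiE isom kill}.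
  - have [u0 u0P] := Fpx_mod_cyclic (redp p beta).
    have isom := local_coker_multiplicity hn hp beta_mon birr phiE bk iso u0P.
    have := Fpx_mod_iso_dvdp (mod_iso_sym isom).
    rewrite -[X in _ %| X]expr1 dvdp_Pexp2l ?birr.1 //.
    by rewrite leqNgt m2.
apply: (local_coker_not_sq hp (U := Fpx_mod (redp p ('X - a%:P))) erefl ij iso1).
by apply/Fpx_mod_ann; rewrite redp_nat // dvdp0.
Qed.
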